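(* Let $(X,\mathcal{C})$ be a uniformly locally finite coarse space. Then $X$ has property A if and only if $X$ has the operator norm localization property.
   Context: For subsets $T, T_1, T_2 \subset X^2$ of the square of a set $X$, write $T^{-1} = \{(x,y) : (y,x) \in T\}$, $T_1 \circ T_2 = \{(x,y) : \exists z \in X,\ (x,z) \in T_1,\ (z,y) \in T_2\}$, and for $x \in X$ write $T[x] = \{y \in X : (y,x) \in T\}$. A subset $Y \subset X$ is $T$-bounded if $Y \subset T[x]$ for some $x \in X$. A coarse structure on $X$ is a family $\mathcal{C}$ of subsets of $X^2$ that contains the diagonal $\Delta_X = \{(x,x) : x \in X\}$ and is closed under $T \mapsto T^{-1}$, under $(T_1,T_2) \mapsto T_1 \circ T_2$, under $(T_1,T_2) \mapsto T_1 \cup T_2$, and under passing to subsets. The pair $(X,\mathcal{C})$ is called a coarse space (it need not be connected or metrizable), and elements of $\mathcal{C}$ are called controlled sets. $(X,\mathcal{C})$ is uniformly locally finite if $\sup_{x \in X} \sharp(T[x]) < \infty$ for every $T \in \mathcal{C}$, where $\sharp$ denotes cardinality. A uniformly locally finite coarse space $(X,\mathcal{C})$ has property A if for every $\epsilon > 0$ and every $T \in \mathcal{C}$ there exist $S \in \mathcal{C}$ and a subset $A \subset S \times \mathbb{N}$ (with $\mathbb{N} = \{1,2,\dots\}$) such that, writing $A_x = \{(y,n) \in X \times \mathbb{N} : (x,y,n) \in A\}$: (i) $A_x$ is finite for every $x \in X$; (ii) $\Delta_X \times \{1\} \subset A$; (iii) $\sharp(A_x \bigtriangleup A_y) < \epsilon\,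 \sharp(A_x \cap A_y)$ whenever $(x,y) \in T$, where $\bigtriangleup$ denotes symmetric difference. For a controlled set $T$, let $E_T = \{a \in \mathbb{B}(\ell^2(X)) : \langle a\delta_y, \delta_x\rangle = 0 \text{ if } (x,y) \in X^2 \setminus T\}$, where $\mathbb{B}(\ell^2(X))$ is the algebra of bounded linear operators on $\ell^2(X)$ and $\{\delta_x\}_{x \in X}$ is the standard orthonormal basis. A uniformly locally finite coarse space $(X,\mathcal{C})$ has the operator norm localization property (ONL) if for every $c < 1$ and every $T \in \mathcal{C}$ there exists a controlled set $S$ such that for every $a \in E_T$ there exists a unit vector $\eta \in \ell^2(X)$ whose support $\mathrm{supp}(\eta)$ is an $S$-bounded set and which satisfies $c\|a\| \le \|a\eta\|$. *)

(* Defs.v *)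
From HB Require Import structures.
From mathcomp Require Import all_boot all_order all_algebra finmap.
From mathcomp Require Import all_classical all_reals all_analysis.
From mathcomp Require Import complex.
From mathcomp Require Import ring lra.
From mathcomp.analysis.showcase Require summability.

Set Implicit Arguments.
Unset Strict Implicit.
Unset Printing Implicit Defensive.

Import Order.TTheory GRing.Theory Num.Theory.
Import numFieldNormedType.Exports.
Import ComplexField.Normc.

Local Open Scope classical_set_scope.
Local Open Scope ring_scope.

(* The library's [T2 \; T1] is {(x, y) | exists z, (x, z) \in T1, (z, y) \in T2},
   i.e. T1 o T2 in the notation of coarse geometry, and [ysection T x] is
   T[x] = {y | (y, x) \in T}. *)
Record coarse_structure (X : Type) (C : set_system (X * X)) : Prop :=
  CoarseStructure {
    coarse_diagonal : C diagonal;
    coarse_inv : forall T, C T -> C (T^-1)%relation;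
    coarse_comp : forall T1 T2, C T1 -> C T2 -> C (T2 \; T1)%relation;
    coarse_setU : forall T1 T2, C T1 -> C T2 -> C (T1 `|` T2);
    coarse_subset : forall T1 T2, T1 `<=` T2 -> C T2 -> C T1
  }.

Definition rel_bounded (X : Type) (T : set (X * X)) (Y : set X) : Prop :=
  exists x, Y `<=` ysection T x.

Definition uniformly_locally_finite (X : Type) (C : set_system (X * X)) : Prop :=
  forall T, C T -> exists N : nat, forall x, (ysection T x #<= `I_N)%card.

Definition fiber (X : Type) (A : set (X * X * nat)) (x : X) : set (X * nat) :=
  [set p | A (x, p.1, p.2)].

Definition property_A (R : realType) (X : choiceType)
    (C : set_system (X * X)) : Prop :=
  forall (eps : R) (T : set (X * X)), 0 < eps -> C T ->
  exists (S : set (X * X)) (A : set (X * X * nat)),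
    [/\ C S /\ A `<=` S `*` [set n | (1 <= n)%N],
        forall x, finite_set (fiber A x),
        diagonal `*` [set 1%N] `<=` A &
        forall x y, T (x, y) ->
          (#|` fset_set (fiber A x `+` fiber A y)|%fset)%:R
            < eps * (#|` fset_set (fiber A x `&` fiber A y)|%fset)%:R].

Section L2.
Variables (R : realType) (X : choiceType).
Implicit Types f g : X -> R[i].

Definition square_summable f : Prop :=
  summable [set: X] (fun x => (normc (f x) ^+ 2)%:E).

Definition l2_pred : {pred X -> R[i]} := fun f => `[< square_summable f >].

Lemma l2_predP f : reflect (square_summable f) (f \in l2_pred).
Proof. exact: asboolP. Qed.

Lemma sqr_normcD (z w : R[i]) :
  normc (z + w) ^+ 2 <= 2 * normc z ^+ 2 + 2 * normc w ^+ 2.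
Proof.
have E (u : R[i]) : normc u ^+ 2 = complex.Re u ^+ 2 + complex.Im u ^+ 2.
  by case: u => a b /=; rewrite sqr_sqrtr// addr_ge0 ?sqr_ge0.
rewrite !E; case: z w => [a b] [c d] /=.
by have := sqr_ge0 (a - c); have := sqr_ge0 (b - d); nra.
Qed.

Lemma square_summable_scale (c : R) f : square_summable f ->
  summable [set: X] (fun x => (c * normc (f x) ^+ 2)%:E).
Proof.
move=> fs.
have natP (n : nat) : summable [set: X] (fun x => (n%:R * normc (f x) ^+ 2)%:E).
  elim: n => [|n IHn].
    by rewrite /summable esum1// => x _; rewrite mul0r abse0.
  apply: le_lt_trans (summableD IHn fs); apply: le_esum => x _ /=.
  by rewrite -natr1 mulrDl mul1r.
have [n cn] : exists n : nat, `|c| <= n%:R.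
  by exists (Num.truncn `|c|).+1; rewrite ltW// truncnS_gt.
apply: le_lt_trans (natP n); apply: le_esum => x _ /=.
rewrite lee_fin normrM [leRHS]normrM normr_nat.
by apply: ler_wpM2r.
Qed.

Lemma l2_submod_closed : submod_closed l2_pred.
Proof.
split=> [|z f g /l2_predP fs /l2_predP gs]; apply/l2_predP.
  rewrite /square_summable /summable esum1// => x _.
  by rewrite normc0 expr0n abse0.
have := summableD (square_summable_scale (2 * normc z ^+ 2) fs)
  (square_summable_scale 2 gs).
apply: le_lt_trans; apply: le_esum => x _ /=.
rewrite lee_fin ger0_norm ?sqr_ge0//.
apply: le_trans (ler_norm _).
by apply: le_trans (sqr_normcD _ _) _; rewrite normcM exprMn mulrA.
Qed.

HB.instance Definition _ :=
  GRing.isSubmodClosed.Build R[i] (X -> R[i]) l2_pred l2_submod_closed.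

Record l2 := L2 { l2_fun :> X -> R[i]; l2_funP : l2_fun \in l2_pred }.

HB.instance Definition _ := [isSub for l2_fun].
HB.instance Definition _ := [Choice of l2 by <:].
HB.instance Definition _ := [SubChoice_isSubLmodule of l2 by <:].

Definition l2_norm (f : l2) : R :=
  Num.sqrt (fine (\esum_(x in [set: X]) (normc (f x) ^+ 2)%:E)%E).

(* The inner product is linear in the first variable; the sum is the limit in
   the field R[i] along the directed set of finite subsets of X. *)
Definition l2_inner (f g : l2) : R[i] :=
  summability.sum (fun x => f x * (g x)^* : R[i]^o).

Lemma delta_in_l2 (y : X) : (fun x : X => (x == y)%:R : R[i]) \in l2_pred.
Proof.
apply/l2_predP; rewrite /square_summable /summable (esumID [set y])//.
rewrite setTI [X in (_ + X)%E]esum1; last first.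
  by move=> x [_ /eqP/negPf /= ->]; rewrite normc0 expr0n /= normr0.
by rewrite esum_set1// adde0 ltry.
Qed.

Definition delta (y : X) : l2 := L2 (delta_in_l2 y).

Lemma l2_inner_delta (f : l2) (x : X) : l2_inner f (delta x) = f x.
Proof.
have tF : ProperFilter (@summability.totally X) := summability.totally_filter.
rewrite /l2_inner /summability.sum.
apply: (@cvg_lim R[i]^o); first exact: norm_hausdorff.
apply: cvg_near_cst; exists [fset x]%fset => // B /=.
rewrite fsub1set => xB; rewrite /summability.partial_sum.
rewrite (bigD1 [` xB]%fset)//= eqxx rmorph1 mulr1 big1 ?addr0// => i.
by rewrite -val_eqE /= => /negPf ->; rewrite rmorph0 mulr0.
Qed.

Definition bounded_operator (a : {linear l2 -> l2}) : Prop :=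
  exists M : R, forall f : l2, l2_norm (a f) <= M * l2_norm f.

Definition operator_norm (a : {linear l2 -> l2}) : R :=
  sup [set l2_norm (a f) | f in [set f : l2 | l2_norm f <= 1]].

Definition operators_on (T : set (X * X)) : set {linear l2 -> l2} :=
  [set a | bounded_operator a /\
           forall x y, ~ T (x, y) -> l2_inner (a (delta y)) (delta x) = 0].

Definition l2_support (f : l2) : set X := [set x | f x != 0].

Definition operator_norm_localization (C : set_system (X * X)) : Prop :=
  forall (c : R) (T : set (X * X)), c < 1 -> C T ->
  exists2 S : set (X * X), C S &
    forall a, operators_on T a ->
      exists eta : l2, [/\ l2_norm eta = 1,
                           rel_bounded S (l2_support eta) &
                           c * operator_norm a <= l2_norm (a eta)].

End L2.

(* Main.v *)
From HB Require Import structures.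
Require Import Defs.
From mathcomp Require Import all_boot all_order all_algebra finmap.
From mathcomp Require Import all_classical all_reals all_analysis.
From mathcomp Require Import complex.
From mathcomp Require Import ring lra zify.

(** Both implications come down to elementary estimates on finitely supported
    vectors.

    Property A implies localization.  Normalizing the indicators of the finite
    sets [A_x] gives unit vectors [xi_x] over [X * nat]
    ([property_A_unit_vectors]) which are close in norm for [(x, y)] in [T] and
    whose coordinate [z] vanishes unless [(x, z.1)] lies in [S].  Cut a finitely
    supported, almost norming vector [f] into the pieces [xi_y(z) f(y)], one for
    each [z].  The squared norms of the pieces add up to that of [f], each piece
    is supported in a set [S[z.1]], and since [a] only connects points related
    by [T], the images of the pieces add up, in square norm, to almost that of
    [a f] ([localized_energy]).  So some piece is almost norming as well.

    Localization implies property A.  For a finite set [F] look for positive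
    kernels [k_z] supported in [S[z]] whose sum [q(x, y)] is close to [1] for
    all [(x, y)] in [T] with both points in [F].  A near-minimizer of the
    squared distance from [q] to the target either is such a solution or yields
    a separating functional ([approximation_or_certificate]): a symmetric
    matrix [a] supported in [T] which is nonnegative on vectors supported in any
    [S[z]], while the sum of its entries is less than [- eps * tr a].
    Localization excludes such an [a] ([localization_no_certificate]): if [b] is
    [a] with its diagonal normalized to [1] and [N] bounds the number of
    [T]-neighbours, then the norm of [N - b] is at least [N + eps], as the
    vector of the square roots of [a x x] shows, but on vectors with [S]-bounded
    support it is at most [N].

    The diagonals [k_z(x, x)] are then probability vectors in [z], up to a small
    error, that vary slowly along [T] ([kernel_diagonal_l1]).  Rounding a large
    multiple of them gives integer multiplicities which are bounded
    independently of [F], so they have a limit along an ultrafilter on the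
    finite subsets of [X] ([global_multiplicity]), and the set of all
    [(x, z, j)] with [j] at most the multiplicity of [z] at [x] witnesses
    property A. *)

Set Implicit Arguments.
Unset Strict Implicit.
Unset Printing Implicit Defensive.

Import Order.TTheory GRing.Theory Num.Theory.
Import numFieldNormedType.Exports.
Import ComplexField.Normc.

Local Open Scope classical_set_scope.
Local Open Scope ring_scope.

Local Notation nsq z := (normc z ^+ 2).

(** * Complex squares and the norm of l2 *)

Section ComplexSquares.
Variable R : realType.
Implicit Types z w : R[i].

Lemma nsqE z : nsq z = complex.Re z ^+ 2 + complex.Im z ^+ 2.
Proof. by case: z => a b /=; rewrite sqr_sqrtr// addr_ge0 ?sqr_ge0. Qed.

Lemma nsq_ge0 z : 0 <= nsq z. Proof. exact: sqr_ge0. Qed.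

Lemma nsqM z w : nsq (z * w) = nsq z * nsq w.
Proof. by rewrite normcM exprMn. Qed.

Lemma nsq_real (r : R) : nsq r%:C%C = r ^+ 2.
Proof. by rewrite nsqE /= expr0n addr0. Qed.

(** The weight [t] is what makes up for Minkowski's inequality: all triangle
    inequalities below are used in this squared form. *)
Lemma nsqD z w (t : R) : 0 < t ->
  nsq (z + w) <= (1 + t) * nsq z + (1 + t^-1) * nsq w.
Proof.
move=> t0; have s0 : 0 < t^-1 by rewrite invr_gt0.
have ts : t * t^-1 = 1 by rewrite divff ?gt_eqF.
have q (a b : R) : 2 * a * b <= t * a ^+ 2 + t^-1 * b ^+ 2.
  rewrite -subr_ge0.
  have -> : t * a ^+ 2 + t^-1 * b ^+ 2 - 2 * a * b =
      t * (a - t^-1 * b) ^+ 2 + (1 - t * t^-1) * (t^-1 * b ^+ 2 - 2 * a * b).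
    by ring.
  by rewrite ts subrr mul0r addr0 mulr_ge0 ?sqr_ge0 ?ltW.
rewrite !nsqE; case: z w => [a b] [c d] /=.
by have := q a c; have := q b d; lra.
Qed.

Lemma ReD z w : complex.Re (z + w) = complex.Re z + complex.Re w.
Proof. by case: z w => [a b] [c d]. Qed.

Lemma ImD z w : complex.Im (z + w) = complex.Im z + complex.Im w.
Proof. by case: z w => [a b] [c d]. Qed.

Lemma Re_sum (I : Type) (r : seq I) (P : pred I) (F : I -> R[i]) :
  complex.Re (\sum_(i <- r | P i) F i) = \sum_(i <- r | P i) complex.Re (F i).
Proof. exact: (big_morph _ ReD). Qed.

Lemma Im_sum (I : Type) (r : seq I) (P : pred I) (F : I -> R[i]) :
  complex.Im (\sum_(i <- r | P i) F i) = \sum_(i <- r | P i) complex.Im (F i).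
Proof. exact: (big_morph _ ImD). Qed.

Lemma sqr_sum_le (I : Type) (r : seq I) (u : I -> R) :
  (\sum_(i <- r) u i) ^+ 2 <= (size r)%:R * \sum_(i <- r) u i ^+ 2.
Proof.
elim: r => [|i r IH]; first by rewrite !big_nil expr0n mulr0.
rewrite !big_cons /= -natr1.
set s := \sum_(j <- r) u j in IH *; set q := \sum_(j <- r) u j ^+ 2 in IH *.
have -> : (u i + s) ^+ 2 = u i ^+ 2 + 2 * u i * s + s ^+ 2 by ring.
have aux (n : nat) (v p : R) : s ^+ 2 <= n%:R * p -> 0 <= p ->
    2 * v * s <= n%:R * v ^+ 2 + p.
  case: n => [|n] sp p0.
    have -> : s = 0.
      by apply/eqP; rewrite -sqrf_eq0; apply/eqP/le_anti; rewrite sqr_ge0 andbT; lra.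
    by lra.
  have n0 : 0 < n.+1%:R :> R by [].
  rewrite -(ler_pM2l n0); have := sqr_ge0 (n.+1%:R * v - s).
  by move: n0 sp; set m : R := n.+1%:R; nra.
have q0 : 0 <= q by apply: sumr_ge0 => j _; exact: sqr_ge0.
by have := aux _ (u i) _ IH q0; nra.
Qed.

Lemma nsq_sum_le (I : Type) (r : seq I) (u : I -> R[i]) :
  nsq (\sum_(i <- r) u i) <= (size r)%:R * \sum_(i <- r) nsq (u i).
Proof.
under [X in _ <= _ * X]eq_bigr do rewrite nsqE.
rewrite nsqE Re_sum Im_sum big_split/= mulrDr.
by apply: lerD; exact: sqr_sum_le.
Qed.

End ComplexSquares.

Lemma sum_fset_sub (V : nmodType) (I : choiceType) (A B : {fset I}) (h : I -> V) :
  (A `<=` B)%fset ->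
  \sum_(x <- A) h x = \sum_(x <- B) (if x \in A then h x else 0).
Proof.
move=> AB; rewrite -(big_fset_incl _ AB) => [|x _ /negPf ->//].
by apply: eq_big_seq => x ->.
Qed.

Section L2Norm.
Variables (R : realType) (X : choiceType).
Implicit Types (f g : l2 R X) (u : X -> R[i]) (F : {fset X}).

Lemma l2_norm_ge0 f : 0 <= l2_norm f.
Proof. exact: sqrtr_ge0. Qed.

Lemma esum_nsq f :
  (\esum_(x in [set: X]) (nsq (f x))%:E = (l2_norm f ^+ 2)%:E)%E.
Proof.
have s0 : (0 <= \esum_(x in [set: X]) (nsq (f x))%:E)%E.
  by apply: esum_ge0 => x _; rewrite lee_fin sqr_ge0.
rewrite /l2_norm sqr_sqrtr ?fine_ge0// fineK// ge0_fin_numE//.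
have /l2_predP := l2_funP f; rewrite /square_summable /summable.
by under eq_esum do rewrite abse_EFin ger0_norm ?sqr_ge0//.
Qed.

Lemma sum_nsq_le f F : \sum_(x <- F) nsq (f x) <= l2_norm f ^+ 2.
Proof.
rewrite -lee_fin -esum_nsq; apply: esum_ge.
exists [set` F]; first by split => //; exact: finite_fset.
by rewrite fsbig_finite//= set_fsetK sumEFin.
Qed.

Lemma l2_norm_fset f F : (forall x, x \notin F -> f x = 0) ->
  l2_norm f ^+ 2 = \sum_(x <- F) nsq (f x).
Proof.
move=> f0; apply: EFin_inj; rewrite -esum_nsq (esumID [set` F]); last first.
  by move=> x _; rewrite lee_fin sqr_ge0.
rewrite [X in (_ + X)%E]esum1 ?adde0; last first.
  by move=> x [_ /negP xF]; rewrite f0// normc0 expr0n.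
rewrite setTI esum_fset//; last by move=> x _; rewrite lee_fin sqr_ge0.
by rewrite fsbig_finite//= set_fsetK sumEFin.
Qed.

(** A squared norm is a supremum of finite sums, so norm estimates reduce to
    finite sums. *)
Lemma l2_norm_le f (b : R) : (forall F, \sum_(x <- F) nsq (f x) <= b) ->
  l2_norm f ^+ 2 <= b.
Proof.
move=> fb; rewrite -lee_fin -esum_nsq; apply: ge_ereal_sup => _ [A [Af _] <-].
by rewrite fsbig_finite//= sumEFin lee_fin.
Qed.

Lemma l2_norm0 : l2_norm (0 : l2 R X) = 0.
Proof.
apply/eqP; rewrite -sqrf_eq0 (@l2_norm_fset _ fset0) ?big_seq_fset0//.
Qed.

Lemma l2_normZ (c : R[i]) f : l2_norm (c *: f) <= normc c * l2_norm f.
Proof.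
have nc : 0 <= normc c by case: (c) => a b /=; exact: sqrtr_ge0.
rewrite -(@ler_pXn2r _ 2)// ?nnegrE ?mulr_ge0 ?l2_norm_ge0//.
rewrite exprMn; apply: l2_norm_le => F.
under eq_bigr do rewrite /= nsqM.
by rewrite -mulr_sumr ler_wpM2l ?sqr_ge0// sum_nsq_le.
Qed.

Lemma l2_normD f g (t : R) : 0 < t ->
  l2_norm (f + g) ^+ 2 <= (1 + t) * l2_norm f ^+ 2 + (1 + t^-1) * l2_norm g ^+ 2.
Proof.
move=> t0; have s0 : 0 < t^-1 by rewrite invr_gt0.
apply: l2_norm_le => F.
apply: (@le_trans _ _ (\sum_(x <- F)
    ((1 + t) * nsq (f x) + (1 + t^-1) * nsq (g x)))).
  by apply: ler_sum => x _; exact: nsqD.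
rewrite big_split/= -!mulr_sumr.
by apply: lerD; rewrite ler_wpM2l ?sum_nsq_le//; lra.
Qed.

(** Finitely supported vectors are described by arbitrary functions, cut off
    outside a finite set. *)
Definition l2_fset_fun F (u : X -> R[i]) (x : X) : R[i] :=
  if x \in F then u x else 0.

Lemma l2_fset_subproof F u : l2_fset_fun F u \in @l2_pred R X.
Proof.
apply/l2_predP; rewrite /square_summable /summable (esumID [set` F])//.
rewrite setTI [X in (_ + X)%E]esum1 ?adde0; last first.
  by move=> x [_ /negP /negPf /= xF]; rewrite /l2_fset_fun xF normc0 expr0n /= normr0.
rewrite esum_fset//.
by rewrite fsbig_finite//= sumEFin ltry.
Qed.

Definition l2_fset F u : l2 R X := L2 (l2_fset_subproof F u).

Lemma l2_fsetE F u x : x \in F -> l2_fset F u x = u x.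
Proof. by rewrite /= /l2_fset_fun => ->. Qed.

Lemma l2_fset0 F u x : x \notin F -> l2_fset F u x = 0.
Proof. by rewrite /= /l2_fset_fun => /negPf ->. Qed.

Lemma l2_fset_norm F u : l2_norm (l2_fset F u) ^+ 2 = \sum_(x <- F) nsq (u x).
Proof.
rewrite (l2_norm_fset (@l2_fset0 F u)).
by apply: eq_big_seq => x xF; rewrite l2_fsetE.
Qed.

Lemma l2P f g : (forall x, f x = g x) -> f = g.
Proof. by move=> fg; apply: val_inj; apply/funext. Qed.

(** Density of finitely supported vectors. *)
Lemma l2_tail f (d : R) : 0 < d ->
  exists F, l2_norm (f - l2_fset F f) ^+ 2 <= d.
Proof.
move=> d0.
have fn : (\esum_(x in [set: X]) (nsq (f x))%:E)%E \is a fin_num by rewrite esum_nsq.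
have [_ [A [Af _] <-]] := ub_ereal_sup_adherent d0 fn.
rewrite -/(esum _ _) esum_nsq fsbig_finite//= sumEFin lte_fin => fA.
exists (fset_set A); apply: l2_norm_le => F.
set B := fset_set A in fA *.
have := sum_nsq_le f (F `|` B)%fset.
suff : \sum_(x <- F) nsq ((f - l2_fset B f) x) + \sum_(x <- B) nsq (f x) <=
    \sum_(x <- (F `|` B)%fset) nsq (f x) by lra.
rewrite (sum_fset_sub _ (fsubsetUl F B)) (sum_fset_sub _ (fsubsetUr F B)).
rewrite -big_split/=; apply: ler_sum => x _.
rewrite (_ : _ + _ = (if x \in F then nsq (f x - l2_fset_fun B f x) else 0) +
  (if x \in B then nsq (f x) else 0))// /l2_fset_fun.
case: (x \in F); case: (x \in B).
- by rewrite subrr normc0 expr0n add0r.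
- by rewrite subr0 addr0.
- by rewrite add0r.
- by rewrite addr0 nsq_ge0.
Qed.

Lemma l2_fset_sum F u : l2_fset F u = \sum_(y <- F) u y *: delta R y.
Proof.
apply: l2P => x.
have -> : (\sum_(y <- F) u y *: delta R y : l2 R X) x =
    \sum_(y <- F) u y * (x == y)%:R.
  exact: (big_morph (fun f : l2 R X => f x) (id1 := 0) (op1 := +%R)).
have [xF|xF] := boolP (x \in F).
  rewrite l2_fsetE// (bigD1_seq x)//= eqxx mulr1 big1 ?addr0// => y /negPf.
  by rewrite eq_sym => ->; rewrite mulr0.
rewrite l2_fset0// big_seq big1// => y yF.
by case: eqP yF xF => [->->//|_ _ _]; rewrite mulr0.
Qed.


Lemma operator_norm_has_sup (a : {linear l2 R X -> l2 R X}) :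
  bounded_operator a ->
  has_sup [set l2_norm (a f) | f in [set f : l2 R X | l2_norm f <= 1]].
Proof.
move=> [M aM]; split; first by exists (l2_norm (a 0)), 0 => //=; rewrite l2_norm0.
exists (Num.max M 0) => _ [f /= f1 <-]; apply: le_trans (aM f) _.
apply: (@le_trans _ _ (Num.max M 0 * l2_norm f)).
  by rewrite ler_wpM2r ?l2_norm_ge0// le_max lexx.
by rewrite ler_piMr// le_max lexx orbT.
Qed.

Lemma le_operator_norm (a : {linear l2 R X -> l2 R X}) f :
  bounded_operator a -> l2_norm (a f) <= operator_norm a * l2_norm f.
Proof.
move=> ab; have := l2_norm_ge0 f; rewrite le_eqVlt => /predU1P[f0|f0].
  by rewrite -f0 mulr0; case: ab => M /(_ f); rewrite -f0 mulr0.
have -> : a f = (l2_norm f)%:C%C *: a ((l2_norm f)^-1%:C%C *: f).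
  rewrite linearZ scalerA -rmorphM divff ?gt_eqF//= scale1r//.
apply: le_trans (l2_normZ _ _) _.
have nr (r : R) : 0 < r -> normc r%:C%C = r.
  by move=> r0; rewrite /= expr0n addr0 sqrtr_sqr gtr0_norm.
rewrite nr// mulrC ler_pM2r//.
apply: sup_upper_bound; first exact: operator_norm_has_sup.
exists ((l2_norm f)^-1%:C%C *: f) => //=.
apply: le_trans (l2_normZ _ _) _.
by rewrite nr ?invr_gt0// mulVf ?gt_eqF.
Qed.

Lemma operator_norm_ge0 (a : {linear l2 R X -> l2 R X}) :
  bounded_operator a -> 0 <= operator_norm a.
Proof.
move=> ab; apply: (@le_trans _ _ (l2_norm (a 0))); first exact: l2_norm_ge0.
apply: sup_upper_bound; first exact: operator_norm_has_sup.
by exists 0 => //=; rewrite l2_norm0.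
Qed.

Lemma l2_norm_delta (y : X) : l2_norm (delta R y) = 1.
Proof.
apply/eqP; rewrite -(@eqrXn2 _ 2) ?l2_norm_ge0// expr1n; apply/eqP.
rewrite (@l2_norm_fset _ [fset y]%fset) => [|x].
  by rewrite big_seq_fset1 /= eqxx -[1%:R]/(1%:C%C) nsq_real expr1n.
by rewrite inE /= => /negPf ->.
Qed.

Lemma entry_le (a : {linear l2 R X -> l2 R X}) x y : bounded_operator a ->
  nsq (a (delta R y) x) <= operator_norm a ^+ 2.
Proof.
move=> ab; have := sum_nsq_le (a (delta R y)) [fset x]%fset.
rewrite big_seq_fset1 => /le_trans; apply.
rewrite ler_pXn2r ?nnegrE ?l2_norm_ge0 ?operator_norm_ge0//.
apply: le_trans (le_operator_norm _ ab) _.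
by rewrite l2_norm_delta mulr1.
Qed.

(** On finitely supported vectors an operator acts through its matrix; no
    continuity is involved. *)
Lemma operator_fset (a : {linear l2 R X -> l2 R X}) F u x :
  a (l2_fset F u) x = \sum_(y <- F) a (delta R y) x * u y.
Proof.
rewrite l2_fset_sum linear_sum.
rewrite (big_morph (fun f : l2 R X => f x) (id1 := 0) (op1 := +%R))//.
by apply: eq_bigr => y _; rewrite linearZ mulrC.
Qed.

End L2Norm.

(** * Coarse neighbourhoods and sparse sums *)

Section CoarseGeometry.
Variables (X : choiceType) (C : set_system (X * X)).
Hypothesis coarseC : coarse_structure C.

(** Reduces both implications to a reflexive and symmetric [T]. *)
Lemma symmetric_enlargement T : C T -> exists T', [/\ C T', T `<=` T',
  forall x, T' (x, x) & forall x y, T' (x, y) -> T' (y, x)].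
Proof.
move=> CT; exists (diagonal `|` (T `|` (T^-1)%relation)); split.
- apply: (coarse_setU coarseC); first exact: coarse_diagonal coarseC.
  by apply: (coarse_setU coarseC) => //; exact: (coarse_inv coarseC).
- by move=> p Tp; right; left.
- by move=> x; left.
- move=> x y [xy|[xy|xy]]; first by left; exact: (esym xy).
    by right; right.
  by right; left.
Qed.

Lemma neighbourhoods T : uniformly_locally_finite C -> C T ->
  exists (N : nat) (nb : X -> {fset X}),
    (forall x y, x \in nb y <-> T (x, y)) /\ (forall y, #|` nb y|%fset <= N)%N.
Proof.
move=> ulf /ulf [N TN]; exists N, (fun y => fset_set (ysection T y)).
have fT y : finite_set (ysection T y) by apply/finite_set_leP; exists N.
split=> [x y|y]; last exact: geq_card_fset_set.
rewrite in_fset_set//; split.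
  by move/set_mem; rewrite /ysection /= inE.
by move=> Txy; apply: mem_set; rewrite /ysection /= inE.
Qed.

End CoarseGeometry.

Section SparseSums.
Variables (R : realType) (X : choiceType).
Implicit Types (G : {fset X}).

(** Cauchy-Schwarz, where only the at most [N] nonzero terms are counted. *)
Lemma nsq_sum_sparse (N : nat) (A G : {fset X}) (u : X -> R[i]) :
  (#|` A|%fset <= N)%N -> (forall y, y \notin A -> u y = 0) ->
  nsq (\sum_(y <- G) u y) <= N%:R * \sum_(y <- G) nsq (u y).
Proof.
move=> AN u0.
have -> : \sum_(y <- G) u y = \sum_(y <- [seq y <- G | y \in A]) u y.
  by rewrite big_filter [LHS](bigID (mem A))/= addrC big1 ?add0r// => y /u0.
apply: le_trans (nsq_sum_le _ _) _; apply: ler_pM => //.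
- by apply: sumr_ge0 => y _; exact: nsq_ge0.
- rewrite ler_nat; apply: leq_trans AN; apply: uniq_leq_size.
    by rewrite filter_uniq.
  by move=> y; rewrite mem_filter => /andP[].
- rewrite big_filter [leRHS](bigID (mem A))/= lerDl.
  by apply: sumr_ge0 => y _; exact: nsq_ge0.
Qed.

(** Each [w y] is counted once for every neighbour of [y] in [G]. *)
Lemma double_count (N : nat) (nb : X -> {fset X}) G (w : X -> R) :
  (forall x, #|` nb x|%fset <= N)%N -> (forall x y, x \in nb y -> y \in nb x) ->
  (forall x, 0 <= w x) ->
  \sum_(x <- G) \sum_(y <- G | y \in nb x) w y <= N%:R * \sum_(y <- G) w y.
Proof.
move=> nbN nbs w0; under eq_bigr do rewrite big_mkcond/=.
rewrite exchange_big mulr_sumr/=; apply: ler_sum => y _.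
rewrite -big_mkcond/= -big_filter big_const_seq count_predT iter_addr_0.
rewrite -[leLHS]mulr_natl ler_wpM2r// ler_nat; apply: leq_trans (nbN y).
apply: uniq_leq_size; first by rewrite filter_uniq.
by move=> x; rewrite mem_filter => /andP[/nbs].
Qed.

End SparseSums.

Section UnitVectors.
Variables (R : realType) (X : choiceType) (C : set_system (X * X)).

Lemma sum_fset_const (I : choiceType) (A W : {fset I}) (c : R) : (A `<=` W)%fset ->
  \sum_(z <- W) (if z \in A then c else 0) = #|` A|%fset%:R * c.
Proof.
move=> AW; rewrite -(sum_fset_sub (fun=> c) AW) big_const_seq count_predT.
by rewrite iter_addr_0 mulr_natl.
Qed.

(** The vector [xi x] is the normalized indicator of the fiber of [A] at [x].
    For two finite sets the squared distance of these is [2 - 2 m p q], with [m]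
    the size of the intersection and [p], [q] the inverse square roots of the
    two sizes; as both sizes are at most [(1 + eps / 2) m], it is at most [eps]. *)
Lemma property_A_unit_vectors (eps : R) T :
  property_A R C -> 0 < eps -> C T ->
  exists (S : set (X * X)) (Z : X -> {fset X * nat}) (xi : X -> X * nat -> R),
  [/\ C S /\ (forall x, S (x, x)),
      forall x z, xi x z != 0 -> z \in Z x /\ S (x, z.1),
      forall x W, (Z x `<=` W)%fset -> \sum_(z <- W) xi x z ^+ 2 = 1 &
      forall x y W, T (x, y) -> (Z x `<=` W)%fset -> (Z y `<=` W)%fset ->
        \sum_(z <- W) (xi x z - xi y z) ^+ 2 <= eps].
Proof.
move=> pA eps0 CT.
have e0 : 0 < eps / 2 by rewrite divr_gt0.
have [S [A [[CS AS] fA DA near]]] := pA (eps / 2) T e0 CT.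
pose Z x := fset_set (fiber A x).
have ZP x z : z \in Z x <-> A (x, z.1, z.2).
  by rewrite in_fset_set//; split; [move/set_mem|move=> ?; exact: mem_set].
pose r x : R := (Num.sqrt #|` Z x|%fset%:R)^-1.
have Z0 x : (0 < #|` Z x|%fset)%N.
  rewrite cardfs_gt0; apply/fset0Pn; exists (x, 1%N); apply/ZP.
  by apply: DA; split.
have r0 x : 0 < r x by rewrite invr_gt0 sqrtr_gt0 ltr0n.
have rE x : #|` Z x|%fset%:R * r x ^+ 2 = 1.
  by rewrite exprVn sqr_sqrtr// divff// gt_eqF// ltr0n.
exists S, Z, (fun x z => if z \in Z x then r x else 0); split.
- by split=> // x; have [] := AS (x, x, 1%N) (DA _ _).
- move=> x z; case: ifP => [zx _|]; last by rewrite eqxx.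
  by split => //; move/ZP : zx => /AS[].
- move=> x W xW; rewrite -[RHS](rE x) -(sum_fset_const _ xW).
  by apply: eq_bigr => z _; case: ifP => // _; rewrite expr0n.
- move=> x y W Txy xW yW.
  have := near _ _ Txy; rewrite fset_setI// -/(Z x) -/(Z y).
  set m := #|` _ `&` _|%fset; set s := #|` _|%fset => sm.
  have leD u v : (u = x /\ v = y) \/ (u = y /\ v = x) ->
      (#|` Z u `\` Z v|%fset <= s)%N.
    move=> uv; apply: fsubset_leq_card; apply/fsubsetP => z.
    rewrite in_fsetD => /andP[/negP zv zu]; rewrite in_fset_set; last first.
      by rewrite finite_setU; split; exact: finite_setD.
    apply: mem_set; case: uv => -[<- <-]; [left|right].
      by split; [exact/ZP|move=> /ZP].
    by split; [exact/ZP|move=> /ZP].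
  have cx : (#|` Z x|%fset <= m + s)%N.
    by rewrite -(cardfsID (Z y) (Z x)) leq_add2l leD//; left.
  have cy : (#|` Z y|%fset <= m + s)%N.
    by rewrite -(cardfsID (Z x) (Z y)) fsetIC leq_add2l leD//; right.
  have -> : \sum_(z <- W) ((if z \in Z x then r x else 0) -
       (if z \in Z y then r y else 0)) ^+ 2 =
      \sum_(z <- W) (if z \in Z x then r x ^+ 2 else 0) +
      \sum_(z <- W) (if z \in Z y then r y ^+ 2 else 0) -
      \sum_(z <- W) (if z \in (Z x `&` Z y)%fset then 2 * r x * r y else 0).
    rewrite -big_split -sumrB/=; apply: eq_bigr => z _; rewrite in_fsetI.
    by case: (z \in Z x); case: (z \in Z y) => /=; ring.
  rewrite !sum_fset_const ?rE//; last by rewrite (fsubset_trans (fsubsetIl _ _)).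
  rewrite -/m.
  have mx : 1 <= (1 + eps / 2) * m%:R * r x ^+ 2.
    rewrite -[leLHS](rE x) ler_wpM2r ?sqr_ge0//.
    move: cx; rewrite -(ler_nat R) natrD; lra.
  have my : 1 <= (1 + eps / 2) * m%:R * r y ^+ 2.
    rewrite -[leLHS](rE y) ler_wpM2r ?sqr_ge0//.
    by move: cy; rewrite -(ler_nat R) natrD; lra.
  have mxy : 1 <= (1 + eps / 2) * (m%:R * (r x * r y)).
    have k0 : 0 <= (1 + eps / 2) * m%:R by rewrite mulr_ge0//; lra.
    rewrite mulrA; case: (leP (r x) (r y)) => rxy.
      apply: le_trans mx _; rewrite ler_wpM2l// expr2 ler_wpM2l// ltW//.
    by apply: le_trans my _; rewrite ler_wpM2l// expr2 ler_wpM2r// ltW.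
  have : m%:R * (r x * r y) <= 1 \/ 1 <= m%:R * (r x * r y).
    by case: (leP 1 (m%:R * (r x * r y))) => [|/ltW]; [right|left].
  have -> : m%:R * (2 * r x * r y) = 2 * (m%:R * (r x * r y)) by ring.
  by set P := m%:R * _ in mxy *; case; nra.
Qed.

End UnitVectors.

(** * Property A implies operator norm localization *)

Section LocalizedEnergy.
Variables (R : realType) (X Y : choiceType).

(** Multiplying [M f] by [xi _ z] differs from applying [M] to the piece
    [xi _ z * f] only by the terms [M x y * (xi x z - xi y z) * f y].  These
    involve neighbours [x], [y] only, so that, summed over [z], they are
    controlled by [d] and the sparsity [N]. *)
Lemma localized_energy (M : X -> X -> R[i]) (L2 d t : R) (N : nat)
    (nb : X -> {fset X}) (G : {fset X}) (W : {fset Y}) (xi : X -> Y -> R)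
    (f : X -> R[i]) :
  (forall x, #|` nb x|%fset <= N)%N -> (forall x y, x \in nb y -> y \in nb x) ->
  (forall x y, y \notin nb x -> M x y = 0) -> (forall x y, nsq (M x y) <= L2) ->
  (forall x, x \in G -> \sum_(z <- W) xi x z ^+ 2 = 1) ->
  (forall x y, x \in G -> y \in G -> y \in nb x ->
     \sum_(z <- W) (xi x z - xi y z) ^+ 2 <= d) ->
  0 < t -> 0 <= d ->
  \sum_(x <- G) nsq (\sum_(y <- G) M x y * f y) <=
    (1 + t) * (\sum_(z <- W) \sum_(x <- G)
                 nsq (\sum_(y <- G) M x y * ((xi y z)%:C%C * f y))) +
    (1 + t^-1) * (N%:R ^+ 2 * L2 * d * \sum_(y <- G) nsq (f y)).
Proof.
move=> nbN nbs M0 ML xi1 xid t0 d0.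
have s0 : 0 < t^-1 by rewrite invr_gt0.
pose D x z := \sum_(y <- G) M x y * ((xi x z - xi y z)%:C%C * f y).
pose A x z := \sum_(y <- G) M x y * ((xi y z)%:C%C * f y).
have xiM x z : (xi x z)%:C%C * (\sum_(y <- G) M x y * f y) = A x z + D x z.
  rewrite -big_split mulr_sumr; apply: eq_bigr => y _ /=.
  by rewrite rmorphB/=; ring.
have step1 x : x \in G -> nsq (\sum_(y <- G) M x y * f y) <=
    (1 + t) * (\sum_(z <- W) nsq (A x z)) + (1 + t^-1) * \sum_(z <- W) nsq (D x z).
  move=> xG; rewrite -[leLHS]mul1r -[X in X * _ <= _](xi1 x xG) mulr_suml.
  rewrite !mulr_sumr -big_split/=.
  by apply: ler_sum => z _; rewrite -[xi x z ^+ 2]nsq_real -nsqM xiM; exact: nsqD.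
have step2 x : x \in G -> \sum_(z <- W) nsq (D x z) <=
    N%:R * (L2 * d * \sum_(y <- G | y \in nb x) nsq (f y)).
  move=> xG; apply: (@le_trans _ _ (\sum_(z <- W) N%:R * \sum_(y <- G)
      nsq (M x y * ((xi x z - xi y z)%:C%C * f y)))).
    apply: ler_sum => z _; apply: (nsq_sum_sparse _ (nbN x)) => y /M0 ->.
    by rewrite mul0r.
  rewrite -mulr_sumr ler_wpM2l// exchange_big/= mulr_sumr.
  rewrite [leRHS]big_mkcond/= big_seq [leRHS]big_seq; apply: ler_sum => y yG.
  case: ifPn => [xy|/M0 ->]; last first.
    by rewrite big1// => z _; rewrite mul0r normc0 expr0n.
  under eq_bigr do rewrite !nsqM nsq_real mulrCA.
  rewrite -mulr_suml mulrA ler_wpM2r ?nsq_ge0// [leLHS]mulrC.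
  by apply: ler_pM; rewrite ?nsq_ge0// ?xid//; apply: sumr_ge0 => z _; exact: sqr_ge0.
apply: (@le_trans _ _ (\sum_(x <- G) ((1 + t) * (\sum_(z <- W) nsq (A x z)) +
    (1 + t^-1) * (N%:R * (L2 * d * \sum_(y <- G | y \in nb x) nsq (f y)))))).
  rewrite big_seq [leRHS]big_seq; apply: ler_sum => x xG.
  by apply: le_trans (step1 x xG) _; rewrite lerD2l ler_wpM2l ?step2//; lra.
rewrite big_split/= -!mulr_sumr exchange_big/= lerD2l ler_wpM2l//; first lra.
have [/eqP L0|x0] := eqVneq (G : seq X) [::].
  by move/eqP : L0 => ->; rewrite !big_nil !mulr0.
have L0 : 0 <= L2.
  by case: (G : seq X) x0 => // x ? _; exact: le_trans (nsq_ge0 _) (ML x x).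
rewrite (_ : N%:R ^+ 2 * L2 * d * _ =
  N%:R * (L2 * d * (N%:R * \sum_(y <- G) nsq (f y)))); last by ring.
rewrite ler_wpM2l// ler_wpM2l ?mulr_ge0//.
by apply: (double_count _ nbN nbs) => y; exact: nsq_ge0.
Qed.

End LocalizedEnergy.

Section AtoONL.
Variables (R : realType) (X : choiceType).

Lemma l2_normZr (r : R) (f : l2 R X) : 0 < r ->
  l2_norm (r%:C%C *: f) = r * l2_norm f.
Proof.
have nr (s : R) : 0 < s -> normc s%:C%C = s.
  by move=> s0; rewrite /= expr0n addr0 sqrtr_sqr gtr0_norm.
move=> r0; apply/le_anti/andP; split.
  by have := l2_normZ r%:C%C f; rewrite nr.
have := l2_normZ (r^-1)%:C%C (r%:C%C *: f); rewrite nr ?invr_gt0//.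
by rewrite scalerA -rmorphM mulVf ?gt_eqF//= scale1r ler_pdivlMl.
Qed.

(** The norm is almost attained in the unit ball, and truncating to a large
    finite set changes little. *)
Lemma near_norming (a : {linear l2 R X -> l2 R X}) (k : R) :
  bounded_operator a -> 0 < operator_norm a -> k < 1 ->
  exists (F : {fset X}) (f : X -> R[i]),
    l2_norm (l2_fset F f) ^+ 2 <= 1 /\
    k * operator_norm a ^+ 2 <= l2_norm (a (l2_fset F f)) ^+ 2.
Proof.
move=> ab L0 k1; set L := operator_norm a in L0 *.
wlog k0 : k k1 / 0 <= k => [H|].
  have [k0|k0] := leP 0 k; first exact: H.
  have [F [f [f1 _]]] := H 0 ltr01 (lexx 0); exists F, f; split=> //.
  apply: le_trans (sqr_ge0 _); rewrite nmulr_rle0//; exact: sqr_ge0.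
pose g := 1 - k; have g0 : 0 < g by rewrite subr_gt0.
have g1 : g <= 1 by rewrite /g; lra.
pose e := g / 8 * L; have e0 : 0 < e by rewrite mulr_gt0// divr_gt0.
have [_ [f /= f1 <-]] := sup_adherent e0 (operator_norm_has_sup ab).
rewrite -/(operator_norm a) -/L => fL.
have t0 : 0 < g / 8 by rewrite divr_gt0.
pose q := 1 + (g / 8)^-1.
have q0 : 0 < q by rewrite addr_gt0// invr_gt0.
pose d := g / 8 / q; have d0 : 0 < d by rewrite divr_gt0.
have [F Fd] := l2_tail f d0.
exists F, f; split.
  rewrite l2_fset_norm; apply: le_trans (sum_nsq_le _ _) _.
  by rewrite -[leRHS](expr1n _ 2) ler_pXn2r ?nnegrE ?l2_norm_ge0.
have := l2_normD (a (l2_fset F f)) (a (f - l2_fset F f)) t0.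
rewrite -linearD addrC subrK -/q.
set u := l2_norm (a (l2_fset F f)) ^+ 2; set v := l2_norm (a (_ - _)) => uv.
have vL : v ^+ 2 <= L ^+ 2 * d.
  apply: (@le_trans _ _ (L ^+ 2 * l2_norm (f - l2_fset F f) ^+ 2)).
    rewrite -exprMn ler_pXn2r ?nnegrE ?mulr_ge0 ?l2_norm_ge0 ?(ltW L0)//.
    exact: le_operator_norm.
  by rewrite ler_wpM2l ?sqr_ge0.
have qv : q * v ^+ 2 <= g / 8 * L ^+ 2.
  apply: (@le_trans _ _ (q * (L ^+ 2 * d))); first by rewrite ler_wpM2l// ltW.
  by rewrite mulrCA /d [q * _]mulrC divfK ?gt_eqF// mulrC.
have fL2 : (1 - g / 8) ^+ 2 * L ^+ 2 <= l2_norm (a f) ^+ 2.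
  have h1 : 0 <= 1 - g / 8 by lra.
  rewrite -exprMn ler_pXn2r ?nnegrE ?l2_norm_ge0 ?mulr_ge0 ?(ltW L0)//.
  by rewrite mulrBl mul1r ltW.
have LL : 0 < L ^+ 2 by rewrite exprn_gt0.
have H : ((1 - g / 8) ^+ 2 - g / 8) * L ^+ 2 <= (1 + g / 8) * u by lra.
rewrite -(@ler_pM2l _ (1 + g / 8)); last by lra.
apply: le_trans H; rewrite mulrA ler_wpM2r ?(ltW LL)//.
have -> : k = 1 - g by rewrite /g; ring.
nra.
Qed.

(** If all pieces [eta z] of an almost norming vector satisfied the reverse
    inequality, then so would the vector itself, up to the error term of
    [localized_energy]. *)
Lemma property_A_localization (C : set_system (X * X)) :
  [set: X] !=set0 -> coarse_structure C -> uniformly_locally_finite C ->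
  property_A R C -> operator_norm_localization R C.
Proof.
move=> [x0 _] coarseC ulf pA c T c1 CT.
have [T' [CT' TT' T'xx T's]] := symmetric_enlargement coarseC CT.
have [N [nb [nbP nbN]]] := neighbourhoods ulf CT'.
have nbs x y : x \in nb y -> y \in nb x by move=> /nbP/T's/nbP.
pose c0 := Num.max c 0.
have c00 : 0 <= c0 by rewrite le_max lexx orbT.
have c01 : c0 < 1 by rewrite gt_max c1 ltr01.
(* The gap [g] absorbs three losses of [g / 4] each: almost norming, the weight
   [1 + t], and the error term of [localized_energy], which [d] makes small. *)
pose g := 1 - c0 ^+ 2; have g0 : 0 < g by rewrite /g; nra.
pose t := g / 4; have t0 : 0 < t by rewrite divr_gt0.
pose q := (1 + t^-1) * (N%:R ^+ 2 + 1).
have q0 : 0 < q.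
  by rewrite mulr_gt0// addr_gt0// ?invr_gt0//; have := sqr_ge0 (N%:R : R); lra.
pose d := g / 4 / q; have d0 : 0 < d by rewrite divr_gt0.
have [S [Z [xi [[CS Sxx] xiS xi1 xid]]]] := property_A_unit_vectors pA d0 CT'.
exists S => // a [ab aT].
set L := operator_norm a.
have aT0 x y : x \notin nb y -> a (delta R y) x = 0.
  by move=> xy; rewrite -l2_inner_delta aT// => /TT'/nbP; exact/negP.
(* If [a = 0], any basis vector will do. *)
have := operator_norm_ge0 ab; rewrite le_eqVlt -/L => /predU1P[L0|L0].
  exists (delta R x0); split; first exact: l2_norm_delta.
  - exists x0 => x xs; rewrite /ysection /= inE.
    have [->//|xx0] := eqVneq x x0.
    by move: xs; rewrite /l2_support /= (negPf xx0) eqxx.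
  - by rewrite -L0 mulr0 l2_norm_ge0.
have [F [f [f1 fL]]] : exists (F : {fset X}) (f : X -> R[i]),
    l2_norm (l2_fset F f) ^+ 2 <= 1 /\
    (1 - g / 4) * L ^+ 2 <= l2_norm (a (l2_fset F f)) ^+ 2.
  by apply: near_norming => //; lra.
(* A finite set containing the supports of [f] and of its image under [a]. *)
pose G := (F `|` \bigcup_(y <- F) nb y)%fset.
have FG : (F `<=` G)%fset by exact: fsubsetUl.
have nbG x y : y \in F -> x \in nb y -> x \in G.
  move=> yF xy; rewrite in_fsetU; apply/orP; right; apply/bigfcupP; exists y => //.
  by rewrite yF.
pose W := (\bigcup_(x <- G) Z x)%fset.
have ZW x : x \in G -> (Z x `<=` W)%fset.
  by move=> xG; apply: bigfcup_sup.
pose f' := l2_fset_fun F f.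
pose eta z := l2_fset G (fun y => (xi y z)%:C%C * f' y).
have aG h x : (forall y, y \notin F -> h y = 0) -> x \notin G ->
    a (l2_fset G h) x = 0.
  move=> h0 xG; rewrite operator_fset big1// => y _.
  have [yF|/h0 ->] := boolP (y \in F); last by rewrite mulr0.
  by rewrite aT0 ?mul0r//; apply: contra xG; exact: nbG.
have f'0 y : y \notin F -> f' y = 0 by exact: (@l2_fset0 _ _ F f).
have fG : l2_fset F f = l2_fset G f'.
  apply: l2P => x; have [xG|xG] := boolP (x \in G); first by rewrite (l2_fsetE _ xG).
  by rewrite !l2_fset0//; apply: contra xG => /(fsubsetP FG).
have aE h : (forall y, y \notin F -> h y = 0) ->
    l2_norm (a (l2_fset G h)) ^+ 2 =
    \sum_(x <- G) nsq (\sum_(y <- G) a (delta R y) x * h y).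
  move=> h0; rewrite (@l2_norm_fset _ _ _ G) => [|x xG]; last first.
    exact: (aG h x h0 xG).
  by apply: eq_bigr => x _; rewrite operator_fset.
have [z zW zL] : exists2 z, z \in W &
    c0 ^+ 2 * L ^+ 2 * l2_norm (eta z) ^+ 2 < l2_norm (a (eta z)) ^+ 2.
  apply: contrapT => no.
  have small z : z \in W ->
      l2_norm (a (eta z)) ^+ 2 <= c0 ^+ 2 * L ^+ 2 * l2_norm (eta z) ^+ 2.
    by move=> zW; rewrite leNgt; apply/negP => ?; apply: no; exists z.
  have := @localized_energy R X _ (fun x y => a (delta R y) x) (L ^+ 2) d t N nb
    G W xi f' nbN nbs.
  have -> : \sum_(x <- G) nsq (\sum_(y <- G) a (delta R y) x * f' y) =
     l2_norm (a (l2_fset F f)) ^+ 2 by rewrite fG aE.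
  have -> : \sum_(y <- G) nsq (f' y) = l2_norm (l2_fset F f) ^+ 2.
    by rewrite fG l2_fset_norm.
  have -> : \sum_(z <- W) \sum_(x <- G)
      nsq (\sum_(y <- G) a (delta R y) x * ((xi y z)%:C%C * f' y)) =
      \sum_(z <- W) l2_norm (a (eta z)) ^+ 2.
    by apply: eq_bigr => z _; rewrite aE// => y /f'0 ->; rewrite mulr0.
  have etaE : \sum_(z <- W) l2_norm (eta z) ^+ 2 = l2_norm (l2_fset F f) ^+ 2.
    rewrite fG l2_fset_norm; under eq_bigr do rewrite l2_fset_norm.
    rewrite exchange_big/=; apply: eq_big_seq => x xG.
    under eq_bigr do rewrite nsqM nsq_real.
    by rewrite -mulr_suml xi1 ?mul1r ?ZW.
  have etaS : \sum_(z <- W) l2_norm (a (eta z)) ^+ 2 <=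
      c0 ^+ 2 * L ^+ 2 * l2_norm (l2_fset F f) ^+ 2.
    rewrite -etaE mulr_sumr big_seq [leRHS]big_seq; apply: ler_sum => z zW.
    exact: small.
  move=> /(_ _ _ _ _ t0 (ltW d0)) H.
  have {}H : l2_norm (a (l2_fset F f)) ^+ 2 <=
     (1 + t) * (\sum_(z <- W) l2_norm (a (eta z)) ^+ 2) +
     (1 + t^-1) * (N%:R ^+ 2 * L ^+ 2 * d * l2_norm (l2_fset F f) ^+ 2).
    apply: H => [x y /(contra (@nbs _ _))|x y|x xG|x y xG yG xy].
    - exact: aT0.
    - exact: entry_le.
    - by rewrite xi1// ZW.
    - by apply: xid; rewrite ?ZW//; apply/nbP/nbs.
  have qd : (1 + t^-1) * (N%:R ^+ 2 * L ^+ 2 * d * l2_norm (l2_fset F f) ^+ 2)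
      <= g / 4 * L ^+ 2.
    have -> : g / 4 = q * d by rewrite /d [RHS]mulrC divfK// gt_eqF.
    have i0 : 0 < 1 + t^-1 by rewrite addr_gt0// invr_gt0.
    rewrite (_ : N%:R ^+ 2 * L ^+ 2 * d * _ =
      N%:R ^+ 2 * l2_norm (l2_fset F f) ^+ 2 * (d * L ^+ 2)); last by ring.
    rewrite -[leRHS]mulrA /q -[leRHS]mulrA ler_wpM2l ?(ltW i0)//.
    rewrite ler_wpM2r//; first by apply: mulr_ge0; rewrite ?sqr_ge0 ?(ltW d0).
    apply: (@le_trans _ _ (N%:R ^+ 2)); last by rewrite lerDl.
    by rewrite ler_piMr// sqr_ge0.
  have LL : 0 < L ^+ 2 by rewrite exprn_gt0.
  have : (1 + t) * (c0 ^+ 2 * L ^+ 2 * l2_norm (l2_fset F f) ^+ 2) <=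
      (1 + t) * (c0 ^+ 2 * L ^+ 2).
    rewrite ler_wpM2l//; first by lra.
    by rewrite ler_piMr// mulr_ge0 ?sqr_ge0.
  have : (1 + t) * (\sum_(z <- W) l2_norm (a (eta z)) ^+ 2) <=
      (1 + t) * (c0 ^+ 2 * L ^+ 2 * l2_norm (l2_fset F f) ^+ 2).
    by rewrite ler_wpM2l//; lra.
  have : (1 + t) * (c0 ^+ 2 * L ^+ 2) + g / 4 * L ^+ 2 < (1 - g / 4) * L ^+ 2.
    rewrite mulrA -mulrDl ltr_pM2r// /t.
    have -> : c0 ^+ 2 = 1 - g by rewrite /g; ring.
    by nra.
  lra.
have e0 : 0 < l2_norm (eta z).
  rewrite lt_neqAle l2_norm_ge0 andbT eq_sym; apply/eqP => e0.
  have := le_operator_norm (eta z) ab; rewrite e0 mulr0 => a0.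
  by move: zL; rewrite (@le_anti _ _ (l2_norm (a (eta z))) 0) ?a0 ?l2_norm_ge0// e0
    expr0n mulr0 ltxx.
exists ((l2_norm (eta z))^-1%:C%C *: eta z); split.
- by rewrite l2_normZr ?invr_gt0// mulVf ?gt_eqF.
- exists z.1 => x; rewrite /l2_support /ysection /= inE => xz.
  apply: (xiS x z _).2; apply: contraNneq xz => xi0.
  have eta0 : eta z x = 0 by rewrite /eta /= /l2_fset_fun xi0 mul0r if_same.
  apply/eqP; rewrite [LHS](_ : _ = (l2_norm (eta z))^-1%:C%C * eta z x)//.
  by rewrite eta0 mulr0.
- rewrite linearZ l2_normZr ?invr_gt0// [leRHS]mulrC ler_pdivlMr//.
  apply: (@le_trans _ _ (c0 * L * l2_norm (eta z))).
    by rewrite ler_wpM2r ?l2_norm_ge0// ler_wpM2r ?(ltW L0)// le_max lexx.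
  rewrite -(@ler_pXn2r _ 2) ?nnegrE ?mulr_ge0 ?l2_norm_ge0 ?(ltW L0)//.
  by rewrite !exprMn ltW.
Qed.

End AtoONL.

(** * Approximation of the constant one, and separating functionals *)

Section DeadZone.
Variables (R : realType) (eps : R).

(** The difference between [t] and its projection to [[- eps, eps]], that is,
    half the derivative of the squared distance to this interval. *)
Definition dead_zone (t : R) : R := t - Num.max (- eps) (Num.min eps t).

Lemma dead_zoneP t : 0 < eps -> [\/ [/\ eps <= t & dead_zone t = t - eps],
  [/\ t <= - eps & dead_zone t = t + eps] | [/\ `|t| <= eps & dead_zone t = 0]].
Proof.
move=> eps0.
rewrite /dead_zone; have [te|te] := leP eps t.
  have ee : - eps <= eps by lra.
  by constructor 1; split=> //; congr (_ - _); apply/max_idPr.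
have [te'|te'] := leP t (- eps).
  by constructor 2; split=> //; rewrite opprK.
by constructor 3; rewrite subrr ler_norml !ltW.
Qed.

(** The squared distance from [t + h] to the interval is at most the squared
    distance to the projection of [t]. *)
Lemma dead_zone_step t h : 0 < eps ->
  dead_zone (t + h) ^+ 2 <= dead_zone t ^+ 2 + 2 * dead_zone t * h + h ^+ 2.
Proof.
move=> eps0.
have -> : dead_zone t ^+ 2 + 2 * dead_zone t * h + h ^+ 2 = (dead_zone t + h) ^+ 2.
  by ring.
have /andP[clip1 clip2] : t - eps <= dead_zone t <= t + eps.
  have [] := dead_zoneP t eps0; move=> [] + -> //; first by lra.
    by lra.
  by rewrite ler_norml => /andP[]; lra.
have [[th ->]|[th ->]|[_ ->]] := dead_zoneP (t + h) eps0.
- by rewrite ler_pXn2r ?nnegrE//; lra.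
- by rewrite -[leLHS]sqrrN -[leRHS]sqrrN ler_pXn2r ?nnegrE//; lra.
- by rewrite expr0n sqr_ge0.
Qed.

Lemma dead_zoneM t : 0 < eps ->
  dead_zone t * t = dead_zone t ^+ 2 + eps * `|dead_zone t|.
Proof.
move=> eps0; have [[te ->]|[te ->]|[_ ->]] := dead_zoneP t eps0; last first.
- by rewrite mul0r expr0n normr0 mulr0 addr0.
- by rewrite ler0_norm; [ring|lra].
- by rewrite ger0_norm; [ring|lra].
Qed.

Lemma le_dead_zone t : 0 < eps -> `|t| <= eps + `|dead_zone t|.
Proof.
move=> eps0; have [[te ->]|[te ->]|[te ->]] := dead_zoneP t eps0; last first.
- by rewrite normr0 addr0.
- by rewrite !ler0_norm; lra.
- by rewrite !ger0_norm; lra.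
Qed.

End DeadZone.

Section Dichotomy.
Variables (R : realType) (I : eqType) (P : seq I) (Q : set (I -> R)) (eps : R).

Let e (q : I -> R) i := dead_zone eps (q i - 1).
Let Phi q := \sum_(i <- P) e q i ^+ 2.

Let Phi_step q h s : 0 < eps -> Phi (fun i => q i + s * h i) <=
  Phi q + 2 * s * (\sum_(i <- P) e q i * h i) + s ^+ 2 * \sum_(i <- P) h i ^+ 2.
Proof.
move=> eps0; rewrite /Phi !mulr_sumr -!big_split/=; apply: ler_sum => i _.
rewrite /e (_ : q i + s * h i - 1 = q i - 1 + s * h i); last by ring.
by apply: le_trans (dead_zone_step _ _ eps0) _; rewrite le_eqVlt; apply/orP; left;
  apply/eqP; ring.
Qed.

(** Let [Phi q] be the sum over [P] of the squared distances from [q i - 1] to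
    [[- eps, eps]].  If the infimum of [Phi] on [Q] is less than [eps ^+ 2], then
    some [q] is as wanted.  Otherwise take a near-minimizer [q] and let [e] be
    half of the derivative of [Phi] at [q].  Moving [q] in a direction [h] which
    stays in [Q] hardly decreases [Phi], so [e] is almost nonnegative on [h].
    Moving [q] towards [0] hardly decreases it either, so the pairing of [e] with
    [q] is almost nonpositive; this pairing equals
    [sum e + Phi q + eps * sum `|e|], where [Phi q] is at least [eps ^+ 2].
    Near-minimizers are used because [Q] may fail to be closed. *)
Lemma approximation_or_certificate : 0 < eps -> Q (fun=> 0) ->
  (forall q (s : R), Q q -> 0 <= s -> s <= 1 -> Q (fun i => s * q i)) ->
  (exists2 q, Q q & forall i, i \in P -> `|q i - 1| <= 2 * eps) \/
  (exists2 rho : R, 0 < rho & forall s : R, 0 < s -> exists q : I -> R, [/\ Q q,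
     (forall (h : I -> R) (b : R), 0 < b ->
       (forall s' : R, 0 <= s' -> Q (fun i => q i + s' * h i)) ->
       \sum_(i <- P) h i ^+ 2 <= b ^+ 2 ->
       - (s * b) <= \sum_(i <- P) dead_zone eps (q i - 1) * h i) &
     \sum_(i <- P) dead_zone eps (q i - 1) +
       eps * (\sum_(i <- P) `|dead_zone eps (q i - 1)|) <= - rho]).
Proof.
move=> eps0 Q0 QZ; pose V := [set Phi q | q in Q]; pose r := inf V.
have Phi_ge0 q : 0 <= Phi q by apply: sumr_ge0 => i _; exact: sqr_ge0.
have iV : has_inf V.
  by split; [exists (Phi (fun=> 0)), (fun=> 0)|exists 0 => _ [q _ <-]].
have rle q : Q q -> r <= Phi q by move=> Qq; apply: ge_inf; [case: iV|exists q].
have e20 : 0 < eps ^+ 2 by rewrite exprn_gt0.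
have [re|re] := ltP r (eps ^+ 2).
  left; have d0 : 0 < eps ^+ 2 - r by rewrite subr_gt0.
  have [_ [q Qq <-] qe] := inf_adherent d0 iV.
  exists q => // i iP; apply: le_trans (le_dead_zone _ eps0) _.
  rewrite mulr_natl mulr2n lerD2l -(@ler_pXn2r _ 2) ?nnegrE ?normr_ge0 ?ltW//.
  rewrite real_normK ?num_real//.
  have {qe} : Phi q < eps ^+ 2 by move: qe; rewrite -/r; lra.
  apply: le_lt_trans; rewrite /Phi (big_rem i)//= lerDl.
  by apply: sumr_ge0 => j _; exact: sqr_ge0.
right; exists (eps ^+ 2 / 2) => [|s s0]; first by rewrite divr_gt0.
(* [B] bounds the squared norm of all near-minimizers; the step [s1] is chosen
   so that the quadratic terms of [Phi_step] are dominated. *)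
pose B := 2 * (1 + eps) ^+ 2 * (size P)%:R + 2 * (Phi (fun=> 0) + 1).
have B0 : 0 <= B.
  have := Phi_ge0 (fun=> 0); have : 0 <= (1 + eps) ^+ 2 * (size P)%:R.
    by rewrite mulr_ge0 ?sqr_ge0.
  by rewrite /B -mulrA; lra.
pose s1 := Num.min s (Num.min 1 (eps ^+ 2 / (1 + B))).
have B10 : 0 < 1 + B by lra.
have s10 : 0 < s1 by rewrite !lt_min s0 ltr01 divr_gt0.
have s1s : s1 <= s by rewrite ge_min lexx.
have s11 : s1 <= 1 by rewrite !ge_min lexx orbT.
have s1B : s1 * (1 + B) <= eps ^+ 2 by rewrite -ler_pdivlMr// !ge_min lexx ?orbT.
have s20 : 0 < s1 ^+ 2 by rewrite exprn_gt0.
have [_ [q Qq <-]] := inf_adherent s20 iV; rewrite -/r => qr.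
exists q; split=> // [h b b0 Qh hb|].
  have s'0 : 0 <= s1 / b by rewrite divr_ge0 ?ltW.
  have := le_trans (rle _ (Qh _ s'0)) (Phi_step q h (s1 / b) eps0).
  rewrite -/(e q _); set E := \sum_(i <- P) e q i * h i => H.
  have H2 : (s1 / b) ^+ 2 * (\sum_(i <- P) h i ^+ 2) <= s1 ^+ 2.
    apply: (@le_trans _ _ ((s1 / b) ^+ 2 * b ^+ 2)).
      by rewrite ler_wpM2l ?sqr_ge0.
    by rewrite -exprMn divfK ?gt_eqF.
  have {H H2} : 0 <= s1 * (E / b + s1).
    have -> : s1 * (E / b + s1) = (s1 / b) * E + s1 ^+ 2 by ring.
    lra.
  rewrite pmulr_rge0// => H.
  apply: (@le_trans _ _ (- (s1 * b))); first by rewrite lerN2 ler_pM2r.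
  have -> : E = (E / b) * b by rewrite divfK ?gt_eqF.
  by rewrite -mulNr ler_pM2r//; lra.
have QB : \sum_(i <- P) q i ^+ 2 <= B.
  apply: (@le_trans _ _ (\sum_(i <- P) (2 * (1 + eps) ^+ 2 + 2 * e q i ^+ 2))).
    apply: ler_sum => i _.
    have : `|q i| <= (1 + eps) + `|e q i|.
      have := le_dead_zone (q i - 1) eps0; rewrite -/(e q i).
      by have := ler_normD (q i - 1) 1; rewrite subrK normr1; lra.
    rewrite -[q i ^+ 2](real_normK (num_real _)).
    rewrite -[e q i ^+ 2](real_normK (num_real _)).
    have := normr_ge0 (q i); have := normr_ge0 (e q i).
    set u := `|q i|; set v := `|e q i| => v0 u0 uv.
    have := sqr_ge0 (1 + eps - v).
    have : u ^+ 2 <= (1 + eps + v) ^+ 2 by rewrite ler_pXn2r ?nnegrE//; lra.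
    by lra.
  rewrite big_split/= big_const_seq count_predT iter_addr_0 -mulr_sumr.
  rewrite -[X in X + _]mulr_natr /B lerD2l ler_wpM2l//.
  rewrite -/(Phi q); have := rle _ Q0.
  have : s1 ^+ 2 <= 1 by rewrite expr_le1// ltW.
  by move: qr; lra.
(* The step from [q] towards [0]. *)
have Qs : Q (fun i => q i + (- s1) * q i).
  have -> : (fun i => q i + (- s1) * q i) = (fun i => (1 - s1) * q i).
    by apply/funext => i; ring.
  by apply: QZ => //; lra.
have := le_trans (rle _ Qs) (Phi_step q q (- s1) eps0).
have -> : \sum_(i <- P) e q i * q i = \sum_(i <- P) e q i + Phi q +
    eps * \sum_(i <- P) `|e q i|.
  rewrite mulr_sumr -!big_split/=; apply: eq_bigr => i _.
  have := dead_zoneM (q i - 1) eps0; rewrite -/(e q i).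
  by rewrite mulrBr mulr1; lra.
rewrite -/(e q _); set E := \sum_(i <- P) e q i; set A := \sum_(i <- P) `|_| => H.
have H2 : (- s1) ^+ 2 * (\sum_(i <- P) q i ^+ 2) <= s1 ^+ 2 * B.
  by rewrite sqrrN ler_wpM2l// sqr_ge0.
have {H H2} : 0 <= s1 * (s1 * (1 + B) - 2 * (E + Phi q + eps * A)).
  have -> : s1 * (s1 * (1 + B) - 2 * (E + Phi q + eps * A)) =
    s1 ^+ 2 + s1 ^+ 2 * B + 2 * (- s1) * (E + Phi q + eps * A) by ring.
  lra.
rewrite pmulr_rge0// => H.
have := rle _ Qq; lra.
Qed.

End Dichotomy.

(** * Symmetric forms and finite matrix operators *)

Section SymmetricForms.
Variables (R : realType) (X : choiceType).
Implicit Types (F : {fset X}) (h : X -> X -> R) (u v : X -> R).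

Definition matrix_form F h u v : R := \sum_(x <- F) \sum_(y <- F) u x * h x y * v y.

Lemma matrix_formC F h u v : (forall x y, h x y = h y x) ->
  matrix_form F h u v = matrix_form F h v u.
Proof.
move=> hs; rewrite /matrix_form exchange_big/=; apply: eq_bigr => x _.
by apply: eq_bigr => y _; rewrite hs; ring.
Qed.

Lemma matrix_form_line F h u v (s : R) : (forall x y, h x y = h y x) ->
  matrix_form F h (fun x => v x + s * u x) (fun x => v x + s * u x) =
  matrix_form F h v v + 2 * s * matrix_form F h u v + s ^+ 2 * matrix_form F h u u.
Proof.
move=> hs; have -> : 2 * s * matrix_form F h u v =
    s * matrix_form F h u v + s * matrix_form F h v u.
  by rewrite (matrix_formC F v u hs); ring.
rewrite /matrix_form !mulr_sumr -!big_split/=; apply: eq_bigr => x _.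
by rewrite !mulr_sumr -!big_split/=; apply: eq_bigr => y _; ring.
Qed.

(** The bound of a self-adjoint matrix by its quadratic form.  The form is
    only evaluated on the combinations of [v] and [h v], which makes the
    estimate local: if [v] has small support, so have these. *)
Lemma symmetric_form_bound F h (N : R) v : 0 < N -> (forall x y, h x y = h y x) ->
  (forall s u, u = (fun x => v x + s * \sum_(y <- F) h x y * v y) ->
     `|matrix_form F h u u| <= N * \sum_(x <- F) u x ^+ 2) ->
  \sum_(x <- F) (\sum_(y <- F) h x y * v y) ^+ 2 <= N ^+ 2 * \sum_(x <- F) v x ^+ 2.
Proof.
move=> N0 hs hb; pose u x := \sum_(y <- F) h x y * v y.
have uv : matrix_form F h u v = \sum_(x <- F) u x ^+ 2.
  apply: eq_bigr => x _; rewrite expr2 [X in _ * X]/u mulr_sumr.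
  by apply: eq_bigr => y _; rewrite mulrA.
have sq s : \sum_(x <- F) (v x + s * u x) ^+ 2 = \sum_(x <- F) v x ^+ 2 +
    2 * s * (\sum_(x <- F) u x * v x) + s ^+ 2 * \sum_(x <- F) u x ^+ 2.
  by rewrite !mulr_sumr -!big_split/=; apply: eq_bigr => x _; ring.
(* Polarization: the forms at [v + s u] and [v - s u] differ by
   [4 * s * form (u, v)], that is, [4 * s] times the squared norm of [u = h v]. *)
have := hb N^-1 _ erefl; have := hb (- N^-1) _ erefl.
rewrite !ler_norml => /andP[lo _] /andP[_ up]; move: lo up.
rewrite !(matrix_form_line _ _ _ _ hs) -/u !sq uv.
set p := \sum_(x <- F) v x ^+ 2; set q := \sum_(x <- F) u x ^+ 2.
set c := matrix_form F h v v; set m := matrix_form F h u u; set w := \sum_(x <- F) _.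
move=> lo up; have {lo up} : 4 * N^-1 * q <= 2 * N * (p + N^-1 ^+ 2 * q) by lra.
have -> : 2 * N * (p + N^-1 ^+ 2 * q) = 2 * N * p + 2 * (N * N^-1) * (N^-1 * q).
  by ring.
rewrite divff ?gt_eqF// => H.
have {}H : N^-1 * q <= N * p by lra.
by move: H; rewrite ler_pdivrMl// mulrA -expr2.
Qed.

End SymmetricForms.

Section MatrixOperator.
Variables (R : realType) (X : choiceType) (F : {fset X}) (h : X -> X -> R).

(** Cutting off outside [F] turns a matrix into a bounded operator on [l2], to
    which localization applies. *)
Definition fset_operator (f : l2 R X) : l2 R X :=
  l2_fset F (fun x => \sum_(y <- F) (h x y)%:C%C * f y).

Fact fset_operator_linear : linear fset_operator.
Proof.
move=> c f g; apply: l2P => x.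
rewrite [RHS](_ : _ = c * fset_operator f x + fset_operator g x)//.
have [xF|xF] := boolP (x \in F); last by rewrite !l2_fset0// mulr0 addr0.
rewrite !(l2_fsetE _ xF) mulr_sumr -big_split/=; apply: eq_bigr => y _.
by rewrite mulrDr mulrCA.
Qed.

HB.instance Definition _ := GRing.isLinear.Build R[i] (l2 R X) (l2 R X) _
  fset_operator fset_operator_linear.

Lemma fset_operator_norm (f : l2 R X) : l2_norm (fset_operator f) ^+ 2 =
  \sum_(x <- F) (\sum_(y <- F) h x y * complex.Re (f y)) ^+ 2 +
  \sum_(x <- F) (\sum_(y <- F) h x y * complex.Im (f y)) ^+ 2.
Proof.
rewrite l2_fset_norm -big_split/=; apply: eq_bigr => x _.
rewrite nsqE Re_sum Im_sum; congr (_ ^+ 2 + _ ^+ 2); apply: eq_bigr => y _.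
  by case: (f y) => a b /=; rewrite mul0r subr0.
by case: (f y) => a b /=; rewrite mul0r addr0.
Qed.

Lemma fset_operator_bounded : bounded_operator fset_operator.
Proof.
have [B B0 Bf] : exists2 B : R, 0 <= B &
    forall f, l2_norm (fset_operator f) ^+ 2 <= B * l2_norm f ^+ 2.
  exists (#|` F|%fset%:R * \sum_(x <- F) \sum_(y <- F) h x y ^+ 2) => [|f].
    rewrite mulr_ge0//; apply: sumr_ge0 => x _; apply: sumr_ge0 => y _.
    exact: sqr_ge0.
  have le1 x : nsq (\sum_(y <- F) (h x y)%:C%C * f y) <=
      #|` F|%fset%:R * ((\sum_(y <- F) h x y ^+ 2) * l2_norm f ^+ 2).
    apply: le_trans (nsq_sum_le _ _) _.
    rewrite ler_wpM2l// [leRHS]mulr_suml; apply: ler_sum => y _.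
    rewrite nsqM nsq_real ler_wpM2l ?sqr_ge0//.
    by have := sum_nsq_le f [fset y]%fset; rewrite big_seq_fset1.
  rewrite l2_fset_norm -mulrA [X in _ * X]mulr_suml [leRHS]mulr_sumr.
  by apply: ler_sum => x _; exact: le1.
exists (Num.sqrt B) => f.
rewrite -(@ler_pXn2r _ 2) ?nnegrE ?mulr_ge0 ?sqrtr_ge0 ?l2_norm_ge0//.
by rewrite exprMn (sqr_sqrtr B0).
Qed.

Lemma fset_operator_delta x y : h x y = 0 -> fset_operator (delta R y) x = 0.
Proof.
move=> hxy; have [xF|xF] := boolP (x \in F); last by rewrite l2_fset0.
rewrite l2_fsetE// big1// => z _ /=; have [->|_] := eqVneq z y.
  by rewrite hxy mul0r.
by rewrite mulr0.
Qed.

End MatrixOperator.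

(** * Localization excludes separating functionals *)

Section LocalizationNoCertificate.
Variables (R : realType) (X : choiceType).

(** Schur's test for a matrix with at most [N] entries per row, all at most [1]. *)
Lemma sparse_form_le (F : {fset X}) (b : X -> X -> R) (N : nat)
    (nb : X -> {fset X}) (v : X -> R) :
  (forall x, #|` nb x|%fset <= N)%N -> (forall x y, x \in nb y -> y \in nb x) ->
  (forall x y, y \notin nb x -> b x y = 0) ->
  (forall x y, x \in F -> y \in F -> `|b x y| <= 1) ->
  `|matrix_form F b v v| <= N%:R * \sum_(x <- F) v x ^+ 2.
Proof.
move=> nbN nbs b0 b1.
have dc := double_count F nbN nbs (fun x => sqr_ge0 (v x)).
have dc' : \sum_(x <- F) \sum_(y <- F | y \in nb x) v x ^+ 2 <=
    N%:R * \sum_(x <- F) v x ^+ 2.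
  apply: le_trans dc; rewrite le_eqVlt; apply/orP; left; apply/eqP.
  under eq_bigr do rewrite big_mkcond/=.
  rewrite exchange_big/=; apply: eq_bigr => x _; rewrite [RHS]big_mkcond/=.
  apply: eq_bigr => y _; rewrite (_ : (x \in nb y) = (y \in nb x))//.
  by apply/idP/idP => /nbs.
apply: (@le_trans _ _ (\sum_(x <- F) \sum_(y <- F | y \in nb x)
    2^-1 * (v x ^+ 2 + v y ^+ 2))); last first.
  under eq_bigr do rewrite -mulr_sumr big_split/=.
  by rewrite -mulr_sumr big_split/=; lra.
apply: le_trans (ler_norm_sum _ _ _) _.
rewrite big_seq [leRHS]big_seq; apply: ler_sum => x xF.
apply: le_trans (ler_norm_sum _ _ _) _; rewrite [leRHS]big_mkcond/=.
rewrite big_seq [leRHS]big_seq; apply: ler_sum => y yF.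
case: ifPn => [_|/b0 ->]; last by rewrite mulr0 mul0r normr0.
rewrite !normrM; have := b1 x y xF yF.
rewrite -[v x ^+ 2](real_normK (num_real _)) -[v y ^+ 2](real_normK (num_real _)).
have := normr_ge0 (b x y); have := normr_ge0 (v x); have := normr_ge0 (v y).
set p := `|v x|; set q := `|v y|; set c := `|b x y| => q0 p0 c0 c1.
have : p * c * q <= p * q.
  by rewrite ler_wpM2r// ler_piMr.
by have := sqr_ge0 (p - q); lra.
Qed.

(** Tests the form on vectors with at most two nonzero coordinates, which give
    the bounds for single entries of locally positive matrices. *)
Lemma matrix_form_pair (F : {fset X}) (a : X -> X -> R) (x y : X) (s t : R) :
  (forall x y, a x y = a y x) -> x \in F -> y \in F ->
  let v := fun u : X => s * (u == x)%:R + t * (u == y)%:R in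
  matrix_form F a v v = s ^+ 2 * a x x + 2 * s * t * a x y + t ^+ 2 * a y y.
Proof.
move=> asym xF yF v.
have pick (g : X -> R) w : w \in F -> \sum_(u <- F) (u == w)%:R * g u = g w.
  move=> wF; rewrite (bigD1_seq w)//= eqxx mul1r big1 ?addr0// => u /negPf ->.
  by rewrite mul0r.
have row u : \sum_(w <- F) v u * a u w * v w = v u * (s * a u x + t * a u y).
  rewrite -(pick (fun w => a u w) x xF) -(pick (fun w => a u w) y yF).
  rewrite !mulr_sumr -big_split mulr_sumr/=; apply: eq_bigr => w _.
  by rewrite /v; ring.
rewrite /matrix_form (eq_bigr _ (fun u _ => row u)).
have -> : s ^+ 2 * a x x + 2 * s * t * a x y + t ^+ 2 * a y y =
    s * (s * a x x + t * a x y) + t * (s * a y x + t * a y y).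
  by rewrite (asym y x); ring.
rewrite -(pick (fun u => s * a u x + t * a u y) x xF).
rewrite -(pick (fun u => s * a u x + t * a u y) y yF).
rewrite !mulr_sumr -big_split/=; apply: eq_bigr => u _.
by rewrite /v; ring.
Qed.

(** Let [w x] be the square root of [a x x] and [b x y] be
    [a x y / (w x * w y)], so that [b] has diagonal [1] and, by positivity on
    pairs, entries at most [1].  Put [h = N - b].  If the conclusion fails, then
    the form of [h] at [w] exceeds [(N + eps) * p], where [p] is the squared norm
    of [w]; hence the operator norm of [h] is at least [N + eps].  On vectors with
    [S]-bounded support [b] is nonnegative and at most [N], so there the form of
    [h] lies between [0] and [N].  For the norm of [h v] one also needs the form
    at [h v], whose support is one [T]-step larger; this is why [S] is a
    composition of [T] with the set [S0] provided by localization. *)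
Lemma localization_no_certificate (C : set_system (X * X)) (T : set (X * X))
    (eps : R) :
  coarse_structure C -> uniformly_locally_finite C ->
  operator_norm_localization R C -> C T -> (forall x, T (x, x)) ->
  (forall x y, T (x, y) -> T (y, x)) -> 0 < eps ->
  exists S : set (X * X), [/\ C S, forall x, S (x, x) &
    forall (F : {fset X}) (a : X -> X -> R), (forall x y, a x y = a y x) ->
      (forall x y, ~ T (x, y) -> a x y = 0) -> (forall x, x \in F -> 0 < a x x) ->
      (forall z (v : X -> R), (forall x, v x != 0 -> S (x, z)) ->
        0 <= matrix_form F a v v) ->
      0 <= matrix_form F a (fun=> 1) (fun=> 1) + eps * \sum_(x <- F) a x x].
Proof.
move=> coarseC ulf onl CT Txx Ts eps0.
have [N0 [nb [nbP nbN0]]] := neighbourhoods ulf CT.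
pose N := N0.+1; have nbN x : (#|` nb x|%fset <= N)%N by exact: leqW.
have nbs x y : x \in nb y -> y \in nb x by move=> /nbP/Ts/nbP.
have N_gt0 : 0 < N%:R :> R by rewrite ltr0n.
pose k : R := N%:R + eps; have k0 : 0 < k by rewrite addr_gt0.
(* The ratio [c] is below [1], but [c * k] still exceeds [N]. *)
pose c := (N%:R + eps / 2) / k.
have c1 : c < 1 by rewrite ltr_pdivrMr// /k; lra.
have [S0 CS0 loc] := onl c T c1 CT.
pose S1 := diagonal `|` S0.
have CS1 : C S1.
  by apply: (coarse_setU coarseC) => //; exact: coarse_diagonal coarseC.
exists (S1 \; T)%relation; split; first exact: (coarse_comp coarseC).
  by move=> x; exists x; [exact: Txx|left].
move=> F a asym aT a0 apos; rewrite leNgt; apply/negP => neg.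
pose w x := Num.sqrt (a x x).
have w0 x : x \in F -> 0 < w x by move=> xF; rewrite sqrtr_gt0 a0.
have wE x : x \in F -> w x ^+ 2 = a x x by move=> xF; rewrite sqr_sqrtr// ltW ?a0.
pose b x y := a x y / (w x * w y).
have bs x y : b x y = b y x by rewrite /b asym mulrC [w x * w y]mulrC mulrC.
have bT x y : ~ T (x, y) -> b x y = 0 by move=> xy; rewrite /b aT ?mul0r.
have bpos z v : (forall x, v x != 0 -> (S1 \; T)%relation (x, z)) ->
    0 <= matrix_form F b v v.
  move=> vz; have := apos z (fun x => v x / w x).
  have -> : matrix_form F a (fun x => v x / w x) (fun x => v x / w x) =
      matrix_form F b v v.
    apply: eq_bigr => x _; apply: eq_bigr => y _; rewrite /b invfM; ring.
  apply=> x; apply: contraNP => xz; apply/eqP.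
  have /eqP -> : v x == 0 by apply: contra_notT xz; exact: vz.
  by rewrite mul0r.
have bxx x : x \in F -> b x x = 1.
  by move=> xF; rewrite /b -(wE x xF) -expr2 divff// sqrf_eq0 gt_eqF// w0.
have b1 x y : x \in F -> y \in F -> `|b x y| <= 1.
  move=> xF yF; have [xy|xy] := pselect (T (x, y)); last by rewrite bT// normr0.
  have pos s : 0 <= 1 ^+ 2 * b x x + 2 * 1 * s * b x y + s ^+ 2 * b y y.
    rewrite -(@matrix_form_pair F)//; apply: (bpos y) => u.
    have [->|ux] := eqVneq u x; first by move=> _; exists y => //; left.
    have [->|uy] := eqVneq u y; first by move=> _; exists y => //; left.
    by rewrite !mulr0 addr0 eqxx.
  have := pos 1; have := pos (-1); rewrite !bxx// ler_norml => p1 p2.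
  by apply/andP; split; lra.
have bnb x y : y \notin nb x -> b x y = 0.
  by move=> xy; apply: bT => /Ts/nbP; exact/negP.
pose h x y := N%:R * (x == y)%:R - b x y.
have hs x y : h x y = h y x by rewrite /h eq_sym bs.
have hT x y : ~ T (x, y) -> h x y = 0.
  move=> xy; rewrite /h (bT _ _ xy) subr0.
  case: eqVneq => [e|]; last by rewrite mulr0.
  by case: xy; rewrite e; exact: Txx.
have hform v : matrix_form F h v v =
    N%:R * (\sum_(x <- F) v x ^+ 2) - matrix_form F b v v.
  rewrite /matrix_form mulr_sumr -sumrB; apply: eq_big_seq => x xF.
  rewrite [X in X - _](_ : _ =
      \sum_(y <- F) v x * (N%:R * (x == y)%:R) * v y).
    rewrite -sumrB; apply: eq_bigr => y _; rewrite /h.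
    by move: (N%:R : R) ((x == y)%:R : R) => n d; ring.
  rewrite (bigD1_seq x)//= eqxx big1 ?addr0 ?mulr1.
    by move: (N%:R : R) => n; ring.
  by move=> y /negPf; rewrite eq_sym => ->; rewrite !mulr0 mul0r.
have hle z v : (forall x, v x != 0 -> (S1 \; T)%relation (x, z)) ->
    `|matrix_form F h v v| <= N%:R * \sum_(x <- F) v x ^+ 2.
  move=> vz; have := bpos z v vz; have := sparse_form_le v nbN nbs bnb b1.
  by rewrite hform !ler_norml => /andP[_ ?] ?; apply/andP; split; lra.
have local z v : (forall x, v x != 0 -> S0 (x, z)) ->
    \sum_(x <- F) (\sum_(y <- F) h x y * v y) ^+ 2 <=
    N%:R ^+ 2 * \sum_(x <- F) v x ^+ 2.
  move=> vz; apply: symmetric_form_bound => // s u ->; apply: (hle z) => x nz.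
  have [vx|vx] := eqVneq (v x) 0; last by exists x; [exact: Txx|right; exact: vz].
  apply: contrapT => xz; move: nz; rewrite vx add0r big1 ?mulr0 ?eqxx// => y _.
  have [vy|vy] := eqVneq (v y) 0; first by rewrite vy mulr0.
  rewrite hT ?mul0r// => xy; apply: xz; exists y => //; right; exact: vz.
pose p := \sum_(x <- F) a x x.
have pw : p = \sum_(x <- F) w x ^+ 2 by apply: eq_big_seq => x /wE ->.
have p0 : 0 < p.
  have [F0|[x0 x0F]] := fset_0Vmem F.
    by move: neg; rewrite /matrix_form F0 !big_seq_fset0 mulr0 addr0 ltxx.
  rewrite /p (bigD1_seq x0)//= ltr_pwDl ?a0// big_seq_cond.
  by apply: sumr_ge0 => x /andP[xF _]; rewrite ltW ?a0.
have hw : k * p < matrix_form F h w w.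
  rewrite hform -pw.
  have -> : matrix_form F b w w = matrix_form F a (fun=> 1) (fun=> 1).
    apply: eq_big_seq => x xF; apply: eq_big_seq => y yF.
    by rewrite mul1r mulr1 mulrAC [LHS]mulrC divfK// mulf_neq0 ?gt_eqF ?w0.
  by move: neg; rewrite -/p /k; lra.
pose H := fset_operator F h.
have Hb : bounded_operator H := fset_operator_bounded F h.
pose wl := l2_fset F (fun x => (w x)%:C%C).
have wlF y : y \in F -> wl y = (w y)%:C%C by move=> yF; exact: l2_fsetE.
have wn : l2_norm wl ^+ 2 = p.
  by rewrite l2_fset_norm pw; apply: eq_bigr => x _; rewrite nsq_real.
have HL : k <= operator_norm H.
  have L0 := operator_norm_ge0 Hb.
  have := le_operator_norm wl Hb.
  rewrite -(@ler_pXn2r _ 2) ?nnegrE ?l2_norm_ge0 ?mulr_ge0 ?l2_norm_ge0//.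
  rewrite exprMn wn fset_operator_norm => HH.
  rewrite -(@ler_pXn2r _ 2) ?nnegrE ?(ltW k0)// -(ler_pM2r p0).
  apply: le_trans HH.
  pose u x := \sum_(y <- F) h x y * w y.
  have uw : \sum_(x <- F) u x * w x = matrix_form F h w w.
    apply: eq_bigr => x _; rewrite mulr_suml; apply: eq_bigr => y _.
    by rewrite /u; ring.
  have uE : \sum_(x <- F) (\sum_(y <- F) h x y * complex.Re (wl y)) ^+ 2 =
      \sum_(x <- F) u x ^+ 2.
    apply: eq_bigr => x _; congr (_ ^+ 2); apply: eq_big_seq => y yF.
    by rewrite wlF.
  rewrite uE; apply: (@le_trans _ _ (\sum_(x <- F) u x ^+ 2)); last first.
    by rewrite lerDl; apply: sumr_ge0 => x _; exact: sqr_ge0.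
  (* The form bound [k * p <= (u, w)] gives a norm bound by expanding the
     square of [u - k w], without Cauchy-Schwarz. *)
  have : 0 <= \sum_(x <- F) (u x - k * w x) ^+ 2.
    by apply: sumr_ge0 => x _; exact: sqr_ge0.
  have -> : \sum_(x <- F) (u x - k * w x) ^+ 2 = \sum_(x <- F) u x ^+ 2 -
      2 * k * (\sum_(x <- F) u x * w x) + k ^+ 2 * \sum_(x <- F) w x ^+ 2.
    by rewrite !mulr_sumr -sumrB -big_split/=; apply: eq_bigr => x _; ring.
  rewrite uw -pw.
  by have := ltW hw; rewrite -(ler_pM2l k0); lra.
have HT : operators_on T H.
  by split=> // x y xy; rewrite l2_inner_delta; apply: fset_operator_delta; exact: hT.
have [eta [eta1 [z etaz] cH]] := loc H HT.
have {cH} : (c * operator_norm H) ^+ 2 <= l2_norm (H eta) ^+ 2.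
  have c0 : 0 <= c by rewrite divr_ge0 ?(ltW k0)// addr_ge0// divr_ge0// ltW.
  by rewrite ler_pXn2r ?nnegrE ?l2_norm_ge0// mulr_ge0 ?operator_norm_ge0.
have ck : N%:R < c * operator_norm H.
  apply: (@lt_le_trans _ _ (c * k)).
    by rewrite /c divfK ?gt_eqF// ltrDl divr_gt0.
  by rewrite ler_wpM2l// divr_ge0 ?(ltW k0)// addr_ge0// divr_ge0// ltW.
rewrite leNgt => /negP; apply.
apply: (@le_lt_trans _ _ (N%:R ^+ 2)); last first.
  by rewrite ltr_pXn2r// nnegrE ltW// (lt_trans _ ck).
rewrite fset_operator_norm.
have S0z (f : X -> R) : (forall x, eta x = 0 -> f x = 0) ->
    forall x, f x != 0 -> S0 (x, z).
  move=> f0 x fx; have : l2_support eta x.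
    by rewrite /l2_support /=; apply: contra_neq fx; exact: f0.
  by move=> /etaz; rewrite /ysection /= inE.
apply: le_trans (lerD (local z _ (S0z _ _)) (local z _ (S0z _ _))) _.
- by move=> x ->.
- by move=> x ->.
rewrite -mulrDr ler_piMr ?sqr_ge0// -big_split/=.
under eq_bigr do rewrite -nsqE.
by apply: le_trans (sum_nsq_le _ _) _; rewrite eta1 expr1n.
Qed.

End LocalizationNoCertificate.

(** * Locally supported positive kernels *)

Section LocalKernels.
Variables (R : realType) (X : choiceType).

(** A family of kernels [k z], each supported in [S[z]] and positive
    semidefinite on pairs of points.  Pairs suffice for the comparison of the
    diagonals, and the condition is visibly stable under the cone operations. *)
Definition local_kernel (S : set (X * X)) (k : X -> X -> X -> R) : Prop :=
  [/\ forall z x y, k z x y = k z y x,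
      forall z x y s t,
        0 <= s ^+ 2 * k z x x + 2 * s * t * k z x y + t ^+ 2 * k z y y &
      forall z x y, k z x y != 0 -> S (x, z) /\ S (y, z)].

Variables (S : set (X * X)) (nz : X -> {fset X}).
Hypothesis nzP : forall x z, z \in nz x <-> S (x, z).

(** Kernels with [z] outside [nz x] vanish at [x]: the sum over [nz x] is the
    sum over all of [X]. *)
Lemma kernel_sum k x y (W : {fset X}) : local_kernel S k -> (nz x `<=` W)%fset ->
  \sum_(z <- W) k z x y = \sum_(z <- nz x) k z x y.
Proof.
move=> [_ _ kS] xW; apply/esym/big_fset_incl => // z _ /negP zx.
by apply/eqP; apply: contra_notT zx => /kS[/nzP].
Qed.

Lemma kernel_sumC k x y : local_kernel S k ->
  \sum_(z <- nz x) k z x y = \sum_(z <- nz y) k z y x.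
Proof.
move=> kl; rewrite -(kernel_sum y kl (fsubsetUl (nz x) (nz y))).
rewrite -(kernel_sum x kl (fsubsetUr (nz x) (nz y))).
by apply: eq_bigr => z _; case: kl => ->.
Qed.

Lemma kernel_ge0 k z x : local_kernel S k -> 0 <= k z x x.
Proof.
case=> _ psd _; have := psd z x x 1 0.
by rewrite expr1n expr0n mul1r mulr0 !mul0r !addr0.
Qed.

(** With [u] and [v] the sum and the difference of the point masses at [x] and
    [y], the number [k z x x - k z y y] is the value of the form [k z] at
    [(u, v)], hence at most [(t * k z (v, v) + t^-1 * k z (u, u)) / 2].  Summed
    over [z], the values at [(v, v)] are at most [4 * d]. *)
Lemma kernel_diagonal_l1 k x y (W : {fset X}) (d t : R) :
  local_kernel S k -> (nz x `<=` W)%fset -> (nz y `<=` W)%fset -> 0 < t ->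
  `|\sum_(z <- nz x) k z x x - 1| <= d ->
  `|\sum_(z <- nz y) k z y y - 1| <= d ->
  `|\sum_(z <- nz x) k z x y - 1| <= d ->
  \sum_(z <- W) `|k z x x - k z y y| <= 2 * d * t + (2 + 2 * d) * t^-1.
Proof.
move=> kl xW yW t0; rewrite -!(kernel_sum _ kl xW) -(kernel_sum _ kl yW).
rewrite !ler_norml => /andP[x1 x2] /andP[y1 y2] /andP[z1 z2].
have s0 : 0 < t^-1 by rewrite invr_gt0.
have ts : t * t^-1 = 1 by rewrite divff ?gt_eqF.
apply: (@le_trans _ _ (\sum_(z <- W) 2^-1 *
    (t * (k z x x + k z y y - 2 * k z x y) +
     t^-1 * (k z x x + k z y y + 2 * k z x y)))).
  apply: ler_sum => z _; case: kl => _ psd _.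
  (* Positivity at the vectors [u + t v] and [- u + t v], divided by [t]. *)
  have p1 := mulr_ge0 (ltW s0) (psd z x y (t + 1) (1 - t)).
  have p2 := mulr_ge0 (ltW s0) (psd z x y (t - 1) (- 1 - t)).
  move: p1 p2; set A := k z x x; set B := k z x y; set D := k z y y.
  have -> : t^-1 * ((t + 1) ^+ 2 * A + 2 * (t + 1) * (1 - t) * B + (1 - t) ^+ 2 * D)
     = t * t^-1 * t * (A + D - 2 * B) + t^-1 * (A + D + 2 * B)
       + 2 * (t * t^-1) * (A - D) by ring.
  have -> : t^-1 * ((t - 1) ^+ 2 * A + 2 * (t - 1) * (- 1 - t) * B +
      (- 1 - t) ^+ 2 * D)
     = t * t^-1 * t * (A + D - 2 * B) + t^-1 * (A + D + 2 * B)
       - 2 * (t * t^-1) * (A - D) by ring.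
  by rewrite ts ler_norml => p1 p2; apply/andP; split; lra.
rewrite -mulr_sumr big_split/= -!mulr_sumr sumrB !big_split/= -!mulr_sumr.
set sx := \sum_(z <- W) k z x x in x1 x2 *.
set sy := \sum_(z <- W) k z y y in y1 y2 *.
set sz := \sum_(z <- W) k z x y in z1 z2 *.
have : t * (sx + sy - 2 * sz) <= t * (4 * d) by rewrite ler_wpM2l ?(ltW t0)//; lra.
have : t^-1 * (sx + sy + 2 * sz) <= t^-1 * (4 + 4 * d).
  by rewrite ler_wpM2l ?(ltW s0)//; lra.
by lra.
Qed.

End LocalKernels.

Section FiniteKernel.
Variables (R : realType) (X : choiceType).

Lemma local_kernel0 (S : set (X * X)) : local_kernel S (fun _ _ _ => 0 : R).
Proof.
split=> // [z x y s t|z x y]; last by rewrite eqxx.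
by rewrite !mulr0 !addr0.
Qed.

Lemma local_kernelZ (S : set (X * X)) (k : X -> X -> X -> R) (c : R) : 0 <= c ->
  local_kernel S k -> local_kernel S (fun z x y => c * k z x y).
Proof.
move=> c0 [ks psd kS]; split=> [z x y|z x y s t|z x y].
- by rewrite ks.
- have := mulr_ge0 c0 (psd z x y s t); congr (0 <= _); ring.
- by rewrite mulf_eq0 negb_or => /andP[_ /kS].
Qed.

Lemma local_kernelD (S : set (X * X)) (k : X -> X -> X -> R) (z0 : X) (v : X -> R)
    (c : R) : 0 <= c -> (forall x, v x != 0 -> S (x, z0)) ->
  local_kernel S k ->
  local_kernel S (fun z x y => k z x y + c * ((z == z0)%:R * (v x * v y))).
Proof.
move=> c0 vS [ks psd kS]; split=> [z x y|z x y s t|z x y].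
- by rewrite ks [v x * _]mulrC.
- have := addr_ge0 (psd z x y s t)
    (mulr_ge0 c0 (mulr_ge0 (ler0n R (z == z0)) (sqr_ge0 (s * v x + t * v y)))).
  by congr (0 <= _); move: ((z == z0)%:R : R) => d; ring.
- have [k0|/kS//] := eqVneq (k z x y) 0; rewrite k0 add0r.
  have [->|_] := eqVneq z z0; last by rewrite mul0r mulr0 eqxx.
  rewrite mulf_eq0 negb_or => /andP[_]; rewrite mul1r mulf_eq0 negb_or.
  by move=> /andP[/vS ? /vS].
Qed.

(** The sums of local kernels form a convex cone containing the rank one
    kernels [v x * v y] for [v] supported in some [S[z]], so a functional
    separating this cone from the kernel [1] is nonnegative on such [v]; that
    functional is excluded by localization. *)
Lemma finite_local_kernel (C : set_system (X * X)) (T : set (X * X)) (eps : R) :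
  coarse_structure C -> uniformly_locally_finite C ->
  operator_norm_localization R C -> C T -> (forall x, T (x, x)) ->
  (forall x y, T (x, y) -> T (y, x)) -> 0 < eps ->
  exists S : set (X * X), [/\ C S, forall x, S (x, x) &
    forall (nz : X -> {fset X}), (forall x z, z \in nz x <-> S (x, z)) ->
    forall F : {fset X}, exists2 k : X -> X -> X -> R, local_kernel S k &
      forall x y, x \in F -> y \in F -> T (x, y) ->
        `|\sum_(z <- nz x) k z x y - 1| <= 2 * eps].
Proof.
move=> coarseC ulf onl CT Txx Ts eps0.
have [S [CS Sxx cert]] := localization_no_certificate coarseC ulf onl CT Txx Ts eps0.
exists S; split=> // nz nzP F.
pose tot (k : X -> X -> X -> R) (p : X * X) := \sum_(z <- nz p.1) k z p.1 p.2.
pose Q := [set tot k | k in local_kernel S].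
pose P := [seq p <- [seq (x, y) | x <- F, y <- F] | `[< T p >]].
have sumP (g : X * X -> R) : \sum_(p <- P) g p =
    \sum_(x <- F) \sum_(y <- F) if `[< T (x, y) >] then g (x, y) else 0.
  by rewrite big_filter big_mkcond/= big_allpairs.
have Q0 : Q (fun=> 0).
  exists (fun _ _ _ => 0); first exact: local_kernel0.
  by apply/funext => p; rewrite /tot big1.
have QZ q (s : R) : Q q -> 0 <= s -> s <= 1 -> Q (fun p => s * q p).
  move=> [k kl <-] s0 _; exists (fun z x y => s * k z x y).
    exact: local_kernelZ.
  by apply/funext => p; rewrite /tot mulr_sumr.
have QD q z (v : X -> R) (s : R) : Q q ->
    (forall x, v x != 0 -> S (x, z)) -> 0 <= s ->
    Q (fun p => q p + s * (v p.1 * v p.2)).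
  move=> [k kl <-] vS s0.
  exists (fun z' x y => k z' x y + s * ((z' == z)%:R * (v x * v y))).
    exact: local_kernelD.
  apply/funext => -[x y]; rewrite /tot big_split/= -mulr_sumr -mulr_suml.
  congr (_ + _ * _).
  have [vx|vx] := eqVneq (v x) 0; first by rewrite vx mul0r mulr0.
  rewrite (bigD1_seq z)/= ?fset_uniq//; last by apply/nzP/vS.
  by rewrite eqxx big1 ?addr0 ?mul1r// => z' /negPf ->.
have [[_ [k kl <-] kP]|[rho rho0 dual]] :=
    approximation_or_certificate P eps0 Q0 QZ.
  exists k => // x y xF yF Txy; apply: (kP (x, y)).
  rewrite mem_filter; apply/andP; split; first exact/asboolP.
  by apply/allpairsP; exists (x, y).
exfalso.
pose n : R := #|` F|%fset%:R; have n0 : 0 <= n by exact: ler0n.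
pose s := rho / (2 * (n + 1) * (1 + eps)).
have den0 : 0 < 2 * (n + 1) * (1 + eps) by rewrite !mulr_gt0//; lra.
have s0 : 0 < s by rewrite divr_gt0.
have [q [Qq loc neg]] := dual s s0.
pose e p := dead_zone eps (q p - 1).
have es x y : e (x, y) = e (y, x).
  case: Qq => k kl kq; rewrite /e -kq /tot/=.
  by rewrite (kernel_sumC nzP x y kl).
(* The functional is nonnegative on the cone only up to [s]; the added diagonal
   makes it positive there, and also makes [a x x] nonzero. *)
pose a x y := (if `[< T (x, y) >] then e (x, y) else 0) + 2 * s * (x == y)%:R.
have Tb x y : `[< T (x, y) >] = `[< T (y, x) >].
  by apply/idP/idP => /asboolP/Ts/asboolP.
have asym x y : a x y = a y x by rewrite /a Tb es eq_sym.
have aT x y : ~ T (x, y) -> a x y = 0.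
  move=> xy; rewrite /a asboolF//; have [exy|_] := eqVneq x y.
    by case: xy; rewrite exy; exact: Txx.
  by rewrite mulr0 addr0.
have axx x : a x x = e (x, x) + 2 * s by rewrite /a asboolT// eqxx mulr1.
have aform (v : X -> R) : matrix_form F a v v =
    \sum_(p <- P) e p * (v p.1 * v p.2) + 2 * s * \sum_(x <- F) v x ^+ 2.
  rewrite (sumP (fun p => e p * (v p.1 * v p.2))) mulr_sumr -big_split/=.
  apply: eq_big_seq => x xF.
  have -> : 2 * s * v x ^+ 2 = \sum_(y <- F) v x * (2 * s * (x == y)%:R) * v y.
    rewrite (bigD1_seq x)//= eqxx big1 ?addr0 ?mulr1; first by ring.
    by move=> y /negPf; rewrite eq_sym => ->; rewrite !mulr0 mul0r.
  rewrite -big_split/=; apply: eq_bigr => y _; rewrite /a.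
  by move: ((x == y)%:R : R) => d; case: ifP => _; ring.
have sqP (v : X -> R) :
    \sum_(p <- P) (v p.1 * v p.2) ^+ 2 <= (\sum_(x <- F) v x ^+ 2) ^+ 2.
  rewrite (sumP (fun p => (v p.1 * v p.2) ^+ 2)) expr2 mulr_suml.
  apply: ler_sum => x _; rewrite mulr_sumr; apply: ler_sum => y _.
  case: ifP => _; first by rewrite exprMn.
  by rewrite mulr_ge0 ?sqr_ge0.
have locv z (v : X -> R) : (forall x, v x != 0 -> S (x, z)) ->
    0 < \sum_(x <- F) v x ^+ 2 ->
    - (s * \sum_(x <- F) v x ^+ 2) <= \sum_(p <- P) e p * (v p.1 * v p.2).
  move=> vS v0; apply: loc => // s' s'0; exact: (QD q z).
have a0 x : x \in F -> 0 < a x x.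
  move=> xF; pose v u : R := 1 * (u == x)%:R + 0 * (u == x)%:R.
  have vE u : v u = (u == x)%:R by rewrite /v mul1r mul0r addr0.
  have sv : \sum_(u <- F) v u ^+ 2 = 1.
    rewrite (bigD1_seq x)//= big1 ?vE ?eqxx ?expr1n ?addr0// => u /negPf ux.
    by rewrite vE ux expr0n.
  have vS u : v u != 0 -> S (u, x).
    have [-> _|ux] := eqVneq u x; first exact: Sxx.
    by rewrite vE (negPf ux) eqxx.
  have := locv x v vS; rewrite sv => /(_ ltr01) H.
  have := aform v; rewrite sv (matrix_form_pair _ _ asym xF xF) => E.
  by move: H E; rewrite !expr1n expr0n /=; lra.
have apos z (v : X -> R) : (forall x, v x != 0 -> S (x, z)) ->
    0 <= matrix_form F a v v.
  move=> vS; rewrite aform.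
  have : 0 <= \sum_(x <- F) v x ^+ 2 by apply: sumr_ge0 => x _; exact: sqr_ge0.
  rewrite le_eqVlt => /predU1P[v0|v0].
    have {}v0 x : x \in F -> v x = 0.
      move=> xF; apply/eqP; rewrite -sqrf_eq0; move/esym/eqP : v0.
      rewrite psumr_eq0 => [/allP/(_ x xF)//|u _]; exact: sqr_ge0.
    rewrite [X in _ + _ * X]big_seq [X in _ + _ * X]big1; last first.
      by move=> x /v0 ->; rewrite expr0n.
    rewrite (sumP (fun p => e p * (v p.1 * v p.2))) big_seq.
    rewrite big1 ?mulr0 ?addr0// => x xF.
    by rewrite big1// => y _; rewrite v0//= mul0r mulr0 if_same.
  have := locv z v vS v0; have := mulr_gt0 s0 v0; lra.
have := cert F a asym aT a0 apos.
have -> : \sum_(x <- F) a x x = \sum_(x <- F) e (x, x) + 2 * s * n.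
  under eq_bigr do rewrite axx.
  rewrite big_split/= big_const_seq count_predT iter_addr_0 -[X in _ + X]mulr_natr.
  by [].
rewrite aform.
have -> : \sum_(p <- P) e p * (1 * 1) = \sum_(p <- P) e p.
  by apply: eq_bigr => p _; rewrite !mulr1.
have -> : \sum_(x <- F) (1 : R) ^+ 2 = n.
  under eq_bigr do rewrite expr1n.
  by rewrite big_const_seq count_predT iter_addr_0.
have diag : \sum_(x <- F) e (x, x) <= \sum_(p <- P) `|e p|.
  rewrite (sumP (fun p => `|e p|)) big_seq [leRHS]big_seq; apply: ler_sum => x xF.
  rewrite (bigD1_seq x)//= asboolT//; apply: le_trans (ler_norm _) _.
  by rewrite lerDl; apply: sumr_ge0 => y _; case: ifP.
have sn : 2 * s * n * (1 + eps) < rho.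
  have -> : rho = s * (2 * (n + 1) * (1 + eps)) by rewrite divfK// gt_eqF.
  have -> : 2 * s * n * (1 + eps) = s * (2 * n * (1 + eps)) by ring.
  by rewrite ltr_pM2l// ltr_pM2r//; lra.
have : eps * \sum_(x <- F) e (x, x) <= eps * \sum_(p <- P) `|e p|.
  by rewrite ler_wpM2l// ltW.
by move: neg; rewrite -/(e _); lra.
Qed.

End FiniteKernel.

(** * Multiplicities, and property A from localization *)

Section Multiplicities.
Variables (R : realType) (X : choiceType).

(** The size of the symmetric difference of the sets below the graphs of
    [n x] and [n y]; the intersection is counted by the next definition. *)
Definition multiplicity_gap (n : X -> X -> nat) (W : {fset X}) (x y : X) : nat :=
  (\sum_(z <- W) (maxn (n x z) (n y z) - minn (n x z) (n y z)))%N.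

Definition multiplicity_overlap (n : X -> X -> nat) (W : {fset X}) (x y : X) : nat :=
  (\sum_(z <- W) minn (n x z) (n y z))%N.

Lemma natr_gap (i j : nat) : (maxn i j - minn i j)%:R = `|i%:R - j%:R| :> R.
Proof.
case: (leqP i j) => [ij|/ltnW ij]; rewrite natrB//.
  by rewrite distrC ger0_norm// subr_ge0 ler_nat.
by rewrite ger0_norm// subr_ge0 ler_nat.
Qed.

(** The multiplicity of [z] at [x] is [M * k z x x] rounded up, for a large
    [M].  The rounding errors are at most [1] for each of the at most [2 * N]
    relevant points [z], hence negligible compared to [M].  The bound [K] does
    not depend on [F], which is what makes a limit over [F] possible. *)
Lemma finite_multiplicity (C : set_system (X * X)) (T : set (X * X)) (eps : R) :
  coarse_structure C -> uniformly_locally_finite C ->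
  operator_norm_localization R C -> C T -> (forall x, T (x, x)) ->
  (forall x y, T (x, y) -> T (y, x)) -> 0 < eps ->
  exists (S : set (X * X)) (K : nat) (nz : X -> {fset X}),
    [/\ C S, forall x z, z \in nz x <-> S (x, z) &
    forall F : {fset X}, exists n : X -> X -> nat,
      [/\ forall x z, z \notin nz x -> n x z = 0%N,
          forall x z, x \in F -> (n x z <= K)%N, forall x, (0 < n x x)%N &
          forall x y, x \in F -> y \in F -> T (x, y) ->
            (multiplicity_gap n (nz x `|` nz y)%fset x y)%:R <
              eps * (multiplicity_overlap n (nz x `|` nz y)%fset x y)%:R]].
Proof.
move=> coarseC ulf onl CT Txx Ts eps0.
pose kap : R := Num.min 1 (eps / (8 * (1 + eps))).
have den0 : 0 < 8 * (1 + eps) by rewrite mulr_gt0// addr_gt0.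
have kap0 : 0 < kap by rewrite lt_min ltr01 divr_gt0.
have kap1 : kap <= 1 by rewrite ge_min lexx.
have kape : kap * (8 * (1 + eps)) <= eps by rewrite -ler_pdivlMr// ge_min lexx orbT.
pose d := kap ^+ 2 / 64.
have kap21 : kap ^+ 2 <= 1 by rewrite expr_le1// ltW.
have d1 : d <= 1 / 64 by rewrite /d ler_pM2r ?invr_gt0.
have e0 : 0 < d / 2 by rewrite divr_gt0// divr_gt0// exprn_gt0.
have [S [CS Sxx ker]] := finite_local_kernel coarseC ulf onl CT Txx Ts e0.
have [N [nz [nzP nzN]]] := neighbourhoods ulf (coarse_inv coarseC CS).
have {}nzP x z : z \in nz x <-> S (x, z) := nzP z x.
(* Both [M * kap] and the rounding error [2 * N] are to be at most
   [M * eps / (8 * (1 + eps))]. *)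
pose M := (Num.truncn (16 * N%:R * (1 + eps) / eps)).+1.
have MN : 16 * N%:R * (1 + eps) < M%:R * eps.
  by rewrite -ltr_pdivrMr// truncnS_gt.
exists S, (M * 2).+1, nz; split=> // F.
have [k kl kF] := ker nz nzP F.
have k0 x z : 0 <= k z x x := kernel_ge0 z x kl.
have kout x z : z \notin nz x -> k z x x = 0.
  move=> /negP zx; case: kl => _ _ kS; apply/eqP.
  by apply: contra_notT zx => /kS[/nzP].
have kF' x y : x \in F -> y \in F -> T (x, y) -> `|\sum_(z <- nz x) k z x y - 1| <= d.
  move=> xF yF /(kF _ _ xF yF) /le_trans; apply.
  by rewrite mulrC divfK.
have M0 z x : 0 <= M%:R * k z x x by rewrite mulr_ge0.
pose n x z := if z \in nz x then
  (if x \in F then (Num.truncn (M%:R * k z x x)).+1 else 1%N) else 0%N.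
have nout x z : z \notin nz x -> n x z = 0%N by rewrite /n => /negPf ->.
have nlow x z : x \in F -> M%:R * k z x x <= (n x z)%:R :> R.
  rewrite /n => ->; case: ifPn => [_|/kout ->]; last by rewrite mulr0.
  by rewrite ltW// truncnS_gt.
have nup x z : x \in F -> (n x z)%:R <= M%:R * k z x x + 1 :> R.
  rewrite /n => ->; case: ifPn => [_|/kout ->]; last by rewrite mulr0 add0r.
  by rewrite -natr1 lerD2r truncn_le.
exists n; split=> [//|x z xF|x|x y xF yF Txy].
- rewrite -(ler_nat R); apply: le_trans (nup _ _ xF) _.
  rewrite -natr1 natrM lerD2r ler_wpM2l//.
  have [zx|/kout ->//] := boolP (z \in nz x).
  have := kF' x x xF xF (Txx x); rewrite ler_norml => /andP[_].
  rewrite (bigD1_seq z)//=; set r := \sum_(_ <- _ | _) _.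
  have : 0 <= r by apply: sumr_ge0.
  by lra.
- rewrite /n; have -> : x \in nz x by apply/nzP.
  by case: ifP.
set W := (nz x `|` nz y)%fset.
have xW : (nz x `<=` W)%fset := fsubsetUl _ _.
have yW : (nz y `<=` W)%fset := fsubsetUr _ _.
have WN : (#|` W|%fset)%:R <= 2 * N%:R :> R.
  rewrite -natrM ler_nat mul2n -addnn; apply: leq_trans (leq_add (nzN x) (nzN y)).
  by rewrite cardfsU leq_subr.
have t0 : 0 < 8 / kap by rewrite divr_gt0.
have l1 : \sum_(z <- W) `|k z x x - k z y y| <= kap.
  have := kernel_diagonal_l1 nzP kl xW yW t0 (kF' _ _ xF xF (Txx x))
    (kF' _ _ yF yF (Txx y)) (kF' _ _ xF yF Txy).
  move/le_trans; apply; rewrite invf_div.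
  have -> : 2 * d * (8 / kap) = kap / 4.
    by rewrite /d; field; rewrite gt_eqF.
  by have := d1; nra.
have gapM : (multiplicity_gap n W x y)%:R <= M%:R * kap + 2 * N%:R :> R.
  apply: (@le_trans _ _ (\sum_(z <- W) (M%:R * `|k z x x - k z y y| + 1))).
    rewrite natr_sum; apply: ler_sum => z _; rewrite natr_gap.
    have := nlow x z xF; have := nlow y z yF; have := nup x z xF; have := nup y z yF.
    have -> : M%:R * `|k z x x - k z y y| = `|M%:R * k z x x - M%:R * k z y y|.
      by rewrite -mulrBr normrM (ger0_norm (ler0n _ _)).
    set u := M%:R * k z x x; set v := M%:R * k z y y => a1 a2 a3 a4.
    rewrite ler_norml; apply/andP; split.
      by have := ler_norm (- (u - v)); rewrite normrN; lra.
    by have := ler_norm (u - v); lra.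
  rewrite big_split/= -mulr_sumr big_const_seq count_predT iter_addr_0.
  by rewrite lerD// ler_wpM2l.
have overlapM : M%:R * (1 - d) - (multiplicity_gap n W x y)%:R <=
    (multiplicity_overlap n W x y)%:R :> R.
  apply: (@le_trans _ _ (\sum_(z <- W)
      (M%:R * k z x x - (maxn (n x z) (n y z) - minn (n x z) (n y z))%:R))).
    rewrite sumrB -natr_sum lerD2r -mulr_sumr ler_wpM2l//.
    rewrite (kernel_sum nzP x kl xW).
    by have := kF' x x xF xF (Txx x); rewrite ler_norml => /andP[]; lra.
  rewrite natr_sum; apply: ler_sum => z _.
  have := nlow x z xF; have : (n x z <= maxn (n x z) (n y z))%N by exact: leq_maxl.
  rewrite -(ler_nat R) natrB ?geq_min ?leq_max ?leqnn//.
  by lra.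
have M1 : 1 <= M%:R :> R by rewrite ler1n.
have : M%:R * kap * (8 * (1 + eps)) <= M%:R * eps by rewrite -mulrA ler_wpM2l.
set D : R := (multiplicity_gap _ _ _ _)%:R in gapM overlapM *.
set I : R := (multiplicity_overlap _ _ _ _)%:R in overlapM *.
move=> Mk.
have DD : (1 + eps) * D <= (1 + eps) * (M%:R * kap + 2 * N%:R).
  by rewrite ler_wpM2l// addr_ge0// ltW.
have Md : M%:R * (1 - d) >= M%:R * 2^-1 by rewrite ler_wpM2l//; lra.
have II : eps * (M%:R * 2^-1 - D) <= eps * I by rewrite ler_wpM2l ?(ltW eps0)//; lra.
have Me : 0 < M%:R * eps by rewrite mulr_gt0//; lra.
by lra.
Qed.

(** A bounded function to [nat] is constant along an ultrafilter. *)
Lemma ultra_bounded_nat (Y : Type) (U : set_system Y) (UU : UltraFilter U)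
    (g : Y -> nat) (K : nat) :
  U [set i | (g i <= K)%N] -> exists k, U [set i | g i = k].
Proof.
elim: K => [|K IH] UK.
  by exists 0%N; apply: filterS UK => i /=; rewrite leqn0 => /eqP.
have [|UC] := in_ultra_setVsetC [set i | g i = K.+1] UU; first by exists K.+1.
apply: IH; apply: filterS (filterI UK UC) => i /= [+ /eqP nK].
by rewrite leq_eqVlt (negPf nK).
Qed.

(** Along an ultrafilter refining the filter of large finite sets, every
    multiplicity is eventually constant; an instance of the required inequality
    involves finitely many of them, so it passes to the limit. *)
Lemma global_multiplicity (C : set_system (X * X)) (T : set (X * X)) (eps : R) :
  coarse_structure C -> uniformly_locally_finite C ->
  operator_norm_localization R C -> C T -> (forall x, T (x, x)) ->
  (forall x y, T (x, y) -> T (y, x)) -> 0 < eps ->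
  exists (S : set (X * X)) (nz : X -> {fset X}) (n : X -> X -> nat),
    [/\ C S /\ forall x z, z \in nz x -> S (x, z),
      forall x z, z \notin nz x -> n x z = 0%N, forall x, (0 < n x x)%N &
      forall x y, T (x, y) ->
        (multiplicity_gap n (nz x `|` nz y)%fset x y)%:R <
          eps * (multiplicity_overlap n (nz x `|` nz y)%fset x y)%:R].
Proof.
move=> coarseC ulf onl CT Txx Ts eps0.
have [S [K [nz [CS nzP mult]]]] := finite_multiplicity coarseC ulf onl CT Txx Ts eps0.
have [nF nFP] := choice mult.
have [U [UU totU]] := ultraFilterLemma (@summability.totally_filter X).
have Ux x : U [set F : {fset X} | x \in F].
  by apply: totU; exists [fset x]%fset => // F /=; rewrite fsub1set.
have lim (p : X * X) : exists k, U [set F | nF F p.1 p.2 = k].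
  apply: (@ultra_bounded_nat _ _ UU _ K); apply: filterS (Ux p.1) => F /= pF.
  by have [_ nK _ _] := nFP F; exact: nK.
have [n' nP] := choice lim.
pose n x z := n' (x, z).
have agree x (W : seq X) : U [set F | forall z, z \in W -> nF F x z = n x z].
  elim: W => [|w W IH]; first by apply: filterS (Ux x).
  apply: filterS (filterI (nP (x, w)) IH) => F /= [Fw FW] z.
  by rewrite inE => /predU1P[->|/FW//]; exact: Fw.
exists S, nz, n; split=> [|x z zx|x|x y Txy].
- by split=> // x z /nzP.
- have [F /= FE] := filter_ex (nP (x, z)).
  rewrite /n -FE; have [n0 _ _ _] := nFP F; exact: n0.
- have [F /= FE] := filter_ex (nP (x, x)).
  rewrite /n -FE; have [_ _ n0 _] := nFP F; exact: n0.
set W := (nz x `|` nz y)%fset.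
have [F /= [[xF yF] [xE yE]]] := filter_ex (filterI (filterI (Ux x) (Ux y))
  (filterI (agree x W) (agree y W))).
have [_ _ _ /(_ x y xF yF Txy)] := nFP F.
rewrite -/W (_ : multiplicity_gap _ _ _ _ = multiplicity_gap n W x y); last first.
  by apply: eq_big_seq => z zW; rewrite xE ?yE.
rewrite (_ : multiplicity_overlap _ _ _ _ = multiplicity_overlap n W x y)//.
by apply: eq_big_seq => z zW; rewrite xE ?yE.
Qed.

Lemma card_fset_set_fibered (I : choiceType) (W : {fset I}) (s : I -> seq nat)
    (B : set (I * nat)) :
  (forall z j, B (z, j) <-> z \in W /\ j \in s z) -> (forall z, uniq (s z)) ->
  finite_set B /\ #|` fset_set B|%fset = (\sum_(z <- W) size (s z))%N.
Proof.
move=> BP us; pose l := [seq (z, j) | z <- W, j <- s z].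
have -> : B = [set` [fset p in l]%fset].
  apply/seteqP; split=> -[z j] /=.
    move=> /BP[zW js]; rewrite !inE/=; apply/allpairsPdep; by exists z, j.
  by rewrite !inE/= => /allpairsPdep[z' [j' [zW js [-> ->]]]]; apply/BP.
split; first exact: finite_fset.
rewrite set_fsetK card_fseq undup_id; last first.
  by apply: allpairs_uniq_dep => // -[z j] [z' j'] _ _ /= [-> ->].
by rewrite size_allpairs_dep sumnE big_map.
Qed.

(** The set [A] consists of the points [(x, z, j)] with
    [1 <= j <= n x z]: differences and intersections of its fibers are counted
    by [multiplicity_gap] and [multiplicity_overlap]. *)
Lemma localization_property_A (C : set_system (X * X)) :
  coarse_structure C -> uniformly_locally_finite C ->
  operator_norm_localization R C -> property_A R C.
Proof.
move=> coarseC ulf onl eps T eps0 CT.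
have [T' [CT' TT' T'xx T's]] := symmetric_enlargement coarseC CT.
have [S [nz [n [[CS nzS] n0 nxx gap]]]] :=
  global_multiplicity coarseC ulf onl CT' T'xx T's eps0.
pose A : set (X * X * nat) := [set p | (1 <= p.2 <= n p.1.1 p.1.2)%N].
have inz x z j : (1 <= j <= n x z)%N -> z \in nz x.
  move=> /andP[j1 jn]; apply: contraTT (leq_trans j1 jn) => /n0 ->.
  by [].
exists S, A; split.
- split=> // -[[x z] j]; rewrite /A /= => jn.
  by split; [exact/nzS/(inz _ _ _ jn)|case/andP: jn].
- move=> x; have [] // := @card_fset_set_fibered X (nz x) (fun z => iota 1 (n x z))
    (fiber A x) _ (fun z => iota_uniq _ _).
  move=> z j; rewrite /fiber /A /= mem_iota add1n ltnS.
  by split=> [jn|[]//]; split=> //; exact: (inz _ _ _ jn).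
- by move=> [[x z] j] [/= xz ->]; rewrite /A /= (xz : x = z) nxx.
move=> x y /TT' Txy; have := gap x y Txy; set W := (nz x `|` nz y)%fset.
have inW z j : (1 <= j <= n x z)%N \/ (1 <= j <= n y z)%N -> z \in W.
  by rewrite in_fsetU => -[/inz ->|/inz ->]; rewrite ?orbT.
have [_ ->] : finite_set (fiber A x `&` fiber A y) /\
    #|` fset_set (fiber A x `&` fiber A y)|%fset = multiplicity_overlap n W x y.
  have [z j|z|fin ->] := @card_fset_set_fibered X W
    (fun z => iota 1 (minn (n x z) (n y z))) (fiber A x `&` fiber A y).
  - rewrite /fiber /A /= mem_iota add1n ltnS leq_min; split.
      move=> [jx jy]; split; first by apply: (inW z j); left.
      by case/andP: jx => -> ->; case/andP: jy.
    by case=> _ /and3P[-> -> ->].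
  - exact: iota_uniq.
  - by split=> //; apply: eq_bigr => z _; rewrite size_iota.
have [_ ->] // : finite_set (fiber A x `+` fiber A y) /\
    #|` fset_set (fiber A x `+` fiber A y)|%fset = multiplicity_gap n W x y.
have [z j|z|fin ->] := @card_fset_set_fibered X W
  (fun z => iota (minn (n x z) (n y z)).+1
                 (maxn (n x z) (n y z) - minn (n x z) (n y z)))
  (fiber A x `+` fiber A y).
- rewrite mem_iota; split.
    move=> [[/= jx jy]|[/= jx jy]]; split.
    + by apply: (inW z j); left.
    + by move: jx jy; rewrite /fiber /A /=; lia.
    + by apply: (inW z j); right.
    + by move: jx jy; rewrite /fiber /A /=; lia.
  move=> [_ jn]; have [xy|xy] := leqP (n x z) (n y z); [right|left].
    by split; rewrite /fiber /A /=; lia.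
  by split; rewrite /fiber /A /=; lia.
- exact: iota_uniq.
- by split=> //; apply: eq_bigr => z _; rewrite size_iota.
Qed.

End Multiplicities.

(** * The equivalence *)

Theorem theorem5p7 (R : realType) (X : choiceType) (C : set_system (X * X))
    (X_neq0 : [set: X] !=set0) (coarseC : coarse_structure C)
    (ulfC : uniformly_locally_finite C) :
  property_A R C <-> operator_norm_localization R C.
Proof.
split; first exact: property_A_localization.
exact: localization_property_A.
Qed.
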